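(* Let $D\subseteq\mathbb{R}_\mathbb{C}$ be an open set invariant under conjugation. The class $\mathcal{DS}(\check{\Omega}_D)$ is a right $\mathbb{DH}$-module and natural extension is a right $\mathbb{DH}$-module isomorphism $\mathcal{S}^{1,0}(\Omega_D)\to\mathcal{DS}(\check{\Omega}_D)$, whose inverse map is restriction to $\Omega_D$. The real vector space $\mathcal{DS}(\check{\Omega}_D)$ admits a unique real $\ast$-algebra structure $(\mathcal{DS}(\check{\Omega}_D),+,\cdot,{}^c)$ making natural extension a real $\ast$-algebra isomorphism. Additionally: for any $f\in\mathcal{S}^{1,0}(\Omega_D)$, the natural extension of the map $x\mapsto f(x^c)$ is the map $x\mapsto\check f(x^c)$, which is therefore itself an element of $\mathcal{DS}(\check{\Omega}_D)$.
   Context: Algebra. $\mathbb{H}$ is the algebra of quaternions with conjugation $x\mapsto x^c$. $\mathbb{DH}=\mathbb{H}+\epsilon\mathbb{H}$ is the algebra of dual quaternions $x=x_1+\epsilon x_2$, with $\epsilon$ central and $\epsilon^2=0$, and $(x_1+\epsilon x_2)^c=x_1^c+\epsilon x_2^c$. A real $\ast$-algebra is a real algebra with an involutive antiautomorphism (here denoted $^c$). $\mathbb{DR}=\mathbb{R}+\epsilon\mathbb{R}$. $\mathbb{S}_\mathbb{DH}=\{J\in\mathbb{DH}: J+J^c=0,\ JJ^c=1\}$. For $A\in\{\mathbb{R},\mathbb{DR},\mathbb{H},\mathbb{DH}\}$, $A_\mathbb{C}=\{a+e_1b:a,b\in A\}$ with $e_1$ central, $e_1^2=-1$, $\overline{a+e_1b}=a-e_1b$,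 $(a+e_1b)^c=a^c+e_1b^c$. Slice functions. $\Omega_D=\{\alpha+J\beta:\alpha+e_1\beta\in D,\ J\in\mathbb{S}_\mathbb{DH}\}$ ($\alpha,\beta\in\mathbb{R}$). A stem function is $F=F_0+e_1F_1:D\to\mathbb{DH}_\mathbb{C}$ with $F(\bar z)=\overline{F(z)}$; stem functions form a real $\ast$-algebra and right $\mathbb{DH}$-module under pointwise operations, including $F^c(z)=F(z)^c$. $F$ induces the slice function $\mathcal{I}(F):\Omega_D\to\mathbb{DH}$, $\mathcal{I}(F)(\alpha+J\beta)=F_0(\alpha+e_1\beta)+JF_1(\alpha+e_1\beta)$. $\mathcal{I}$ is injective and a right $\mathbb{DH}$-module isomorphism onto its image, the set of slice functions on $\Omega_D$, which has the unique real $\ast$-algebra structure (with product $\cdot$ and conjugation $^c$) making $\mathcal{I}$ a $\ast$-algebra isomorphism. $\mathcal{S}^{1,0}(\Omega_D)$ is its $\ast$-subalgebra and right $\mathbb{DH}$-submodule consisting of all $\mathcal{I}(G+\epsilon H)$ with $G,H:D\to\mathbb{H}_\mathbb{C}$ stem functions, $G$ of class $C^1$ and $H$ continuous. Natural extension. Let $\check D=D+\epsilon\mathbb{R}_\mathbb{C}$ and $\check{\Omega}_D=\Omega_D+\epsilon\mathbb{H}=\{a+Ib: a,b\in\mathbb{DR},\ a+e_1b\in\check D,\ I\in\mathbb{S}_\mathbb{DH}\}$. For $f=\mathcal{I}(F)\in\mathcal{S}^{1,0}(\Omega_D)$, $F=G+\epsilon H$ with $G,H:D\to\mathbb{H}_\mathbb{C}$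 stem functions, $G$ of class $C^1$ and $H$ continuous, $G=G_0+e_1G_1$, $H=H_0+e_1H_1$, set, for $\ell=0,1$, $a=a_1+\epsilon a_2,b=b_1+\epsilon b_2\in\mathbb{DR}$ and $z_1=a_1+e_1b_1\in D$, $$\check F_\ell(a+e_1b)=G_\ell(z_1)+\epsilon\Big(H_\ell(z_1)+a_2\tfrac{\partial G_\ell}{\partial\alpha}(z_1)+b_2\tfrac{\partial G_\ell}{\partial\beta}(z_1)\Big).$$ The natural extension of $f$ is the (well-defined) function $\check f:\check{\Omega}_D\to\mathbb{DH}$, $\check f(a+Ib)=\check F_0(a+e_1b)+I\check F_1(a+e_1b)$. $\mathcal{DS}(\check{\Omega}_D)=\{\check f:f\in\mathcal{S}^{1,0}(\Omega_D)\}$, the set of dual slice functions on $\check{\Omega}_D$; its addition and right $\mathbb{DH}$-multiplication are pointwise. *)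

(* Defs.v *)
From HB Require Import structures.
From mathcomp Require Import all_boot all_order all_algebra.
From mathcomp Require Import ring.
From mathcomp Require Import all_classical all_reals all_analysis.

Set Implicit Arguments.
Unset Strict Implicit.
Unset Printing Implicit Defensive.

Import Order.TTheory GRing.Theory Num.Theory.
Import numFieldNormedType.Exports.

Local Open Scope classical_set_scope.
Local Open Scope ring_scope.

(* The row [:: q0; q1; q2; q3] is q0 + q1 i + q2 j + q3 k.  Row vectors are used
   because they carry the product topology of R^4, and because, unlike iterated
   pairs, they carry no other ring structure. *)
Definition quat (R : realType) : Type := 'rV[R]_4.

HB.instance Definition _ (R : realType) :=
  NormedModule.copy (quat R) 'rV[R]_4.

Section Quaternions.
Variable R : realType.
Implicit Types x y z : quat R.

Definition mkquat (a b c d : R) : quat R := \row_(i < 4) [:: a; b; c; d]`_i.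

Definition qcoord x (k : nat) : R := x ord0 (inord k).

Definition quat_one : quat R := mkquat 1 0 0 0.

Definition quat_mul x y : quat R :=
  let a := qcoord x 0 in let a' := qcoord y 0 in
  let b := qcoord x 1 in let b' := qcoord y 1 in
  let c := qcoord x 2 in let c' := qcoord y 2 in
  let d := qcoord x 3 in let d' := qcoord y 3 in
  mkquat (a * a' - b * b' - c * c' - d * d')
         (a * b' + b * a' + c * d' - d * c')
         (a * c' - b * d' + c * a' + d * b')
         (a * d' + b * c' - c * b' + d * a').

Definition quat_conj x : quat R :=
  mkquat (qcoord x 0) (- qcoord x 1) (- qcoord x 2) (- qcoord x 3).

Lemma qcoord0 a b c d : qcoord (mkquat a b c d) 0 = a.
Proof. by rewrite /qcoord mxE inordK. Qed.

Lemma qcoord1 a b c d : qcoord (mkquat a b c d) 1 = b.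
Proof. by rewrite /qcoord mxE inordK. Qed.

Lemma qcoord2 a b c d : qcoord (mkquat a b c d) 2 = c.
Proof. by rewrite /qcoord mxE inordK. Qed.

Lemma qcoord3 a b c d : qcoord (mkquat a b c d) 3 = d.
Proof. by rewrite /qcoord mxE inordK. Qed.

Definition qcoordE := (qcoord0, qcoord1, qcoord2, qcoord3).

Lemma qcoordD x y k : qcoord (x + y) k = qcoord x k + qcoord y k.
Proof. by rewrite /qcoord mxE. Qed.

Lemma qcoordZ (r : R) x k : qcoord (r *: x) k = r * qcoord x k.
Proof. by rewrite /qcoord mxE. Qed.

Lemma quatP x y : qcoord x 0 = qcoord y 0 -> qcoord x 1 = qcoord y 1 ->
  qcoord x 2 = qcoord y 2 -> qcoord x 3 = qcoord y 3 -> x = y.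
Proof.
move=> e0 e1 e2 e3; apply/rowP => i; rewrite -[i]inord_val.
by case: i => -[|[|[|[|//]]]] /= _; [exact: e0|exact: e1|exact: e2|exact: e3].
Qed.

Lemma quat_mulA : associative quat_mul.
Proof. by move=> x y z; apply: quatP; rewrite /quat_mul !qcoordE; ring. Qed.

Lemma quat_mul1r : left_id quat_one quat_mul.
Proof.
by move=> x; apply: quatP; rewrite /quat_mul /quat_one !qcoordE; ring.
Qed.

Lemma quat_mulr1 : right_id quat_one quat_mul.
Proof.
by move=> x; apply: quatP; rewrite /quat_mul /quat_one !qcoordE; ring.
Qed.

Lemma quat_mulDl : left_distributive quat_mul +%R.
Proof.
move=> x y z.
by apply: quatP; rewrite qcoordD /quat_mul !qcoordE !qcoordD; ring.
Qed.

Lemma quat_mulDr : right_distributive quat_mul +%R.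
Proof.
move=> x y z.
by apply: quatP; rewrite qcoordD /quat_mul !qcoordE !qcoordD; ring.
Qed.

Lemma quat_one_neq0 : quat_one != 0.
Proof.
apply/eqP => /(congr1 (qcoord^~ 0%N)) /eqP.
by rewrite /quat_one qcoord0 /qcoord mxE oner_eq0.
Qed.

HB.instance Definition _ := GRing.Zmodule_isNzRing.Build (quat R)
  quat_mulA quat_mul1r quat_mulr1 quat_mulDl quat_mulDr quat_one_neq0.

Lemma quat_scalerAl (k : R) x y : k *: (x * y) = (k *: x) * y.
Proof.
rewrite -[RHS]/(quat_mul _ _) -[x * y]/(quat_mul x y).
by apply: quatP; rewrite qcoordZ /quat_mul !qcoordE !qcoordZ; ring.
Qed.

Lemma quat_scalerAr (k : R) x y : k *: (x * y) = x * (k *: y).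
Proof.
rewrite -[RHS]/(quat_mul _ _) -[x * y]/(quat_mul x y).
by apply: quatP; rewrite qcoordZ /quat_mul !qcoordE !qcoordZ; ring.
Qed.

HB.instance Definition _ :=
  GRing.Lmodule_isLalgebra.Build R (quat R) quat_scalerAl.
HB.instance Definition _ :=
  GRing.Lalgebra_isAlgebra.Build R (quat R) quat_scalerAr.

End Quaternions.

(* The pair (x1, x2) is x1 + eps x2. *)
Definition dual (A : Type) : Type := (A * A)%type.

HB.instance Definition _ (A : zmodType) :=
  GRing.Zmodule.copy (dual A) (A * A)%type.
HB.instance Definition _ (K : pzRingType) (A : lmodType K) :=
  GRing.Lmodule.copy (dual A) (A * A)%type.

Definition mkdual (A : Type) (x1 x2 : A) : dual A := (x1, x2).
Definition dual1 (A : Type) (x : dual A) : A := x.1.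
Definition dual2 (A : Type) (x : dual A) : A := x.2.

Section DualRing.
Variable A : nzRingType.
Implicit Types x y z : dual A.

Definition dual_mul x y : dual A :=
  mkdual (dual1 x * dual1 y) (dual1 x * dual2 y + dual2 x * dual1 y).

Lemma dual_mulA : associative dual_mul.
Proof.
move=> [a b] [c d] [e f]; congr (_, _) => /=; first exact: mulrA.
by rewrite mulrDr mulrDl !mulrA addrA.
Qed.

Lemma dual_mul1r : left_id (mkdual 1 0) dual_mul.
Proof. by move=> [a b]; congr (_, _); rewrite /= !mul1r ?mul0r ?addr0. Qed.

Lemma dual_mulr1 : right_id (mkdual 1 0) dual_mul.
Proof. by move=> [a b]; congr (_, _); rewrite /= !mulr1 ?mulr0 ?add0r. Qed.

Lemma dual_mulDl : left_distributive dual_mul +%R.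
Proof.
move=> [a b] [c d] [e f]; congr (_, _) => /=; first exact: mulrDl.
by rewrite !mulrDl addrACA.
Qed.

Lemma dual_mulDr : right_distributive dual_mul +%R.
Proof.
move=> [a b] [c d] [e f]; congr (_, _) => /=; first exact: mulrDr.
by rewrite !mulrDr addrACA.
Qed.

Lemma dual_one_neq0 : mkdual 1 0 != 0 :> dual A.
Proof. by apply/eqP => -[] /eqP; rewrite oner_eq0. Qed.

HB.instance Definition _ := GRing.Zmodule_isNzRing.Build (dual A)
  dual_mulA dual_mul1r dual_mulr1 dual_mulDl dual_mulDr dual_one_neq0.

End DualRing.

Section DualAlgebra.
Variables (K : pzRingType) (A : algType K).
Implicit Types x y : dual A.

Lemma dual_scalerAl (k : K) x y : k *: dual_mul x y = dual_mul (k *: x) y.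
Proof.
case: x y => [a b] [c d]; congr (_, _) => /=; first exact: scalerAl.
by rewrite scalerDr !scalerAl.
Qed.

Lemma dual_scalerAr (k : K) x y : k *: dual_mul x y = dual_mul x (k *: y).
Proof.
case: x y => [a b] [c d]; congr (_, _) => /=; first exact: scalerAr.
by rewrite scalerDr !scalerAr.
Qed.

HB.instance Definition _ :=
  GRing.Lmodule_isLalgebra.Build K (dual A) dual_scalerAl.
HB.instance Definition _ :=
  GRing.Lalgebra_isAlgebra.Build K (dual A) dual_scalerAr.

End DualAlgebra.

(* The pair (a, b) is a + e1 b. *)
Definition cplx (A : Type) : Type := (A * A)%type.

HB.instance Definition _ (A : zmodType) :=
  GRing.Zmodule.copy (cplx A) (A * A)%type.
HB.instance Definition _ (K : pzRingType) (A : lmodType K) :=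
  GRing.Lmodule.copy (cplx A) (A * A)%type.
HB.instance Definition _ (K : numFieldType) (A : normedModType K) :=
  NormedModule.copy (cplx A) (A * A)%type.

Definition mkcplx (A : Type) (a b : A) : cplx A := (a, b).
Definition cplx0 (A : Type) (z : cplx A) : A := z.1.
Definition cplx1 (A : Type) (z : cplx A) : A := z.2.
Definition cplx_bar (A : zmodType) (z : cplx A) : cplx A :=
  mkcplx (cplx0 z) (- cplx1 z).

Section CplxRing.
Variable A : nzRingType.
Implicit Types x y z : cplx A.

Definition cplx_mul x y : cplx A :=
  mkcplx (cplx0 x * cplx0 y - cplx1 x * cplx1 y)
         (cplx0 x * cplx1 y + cplx1 x * cplx0 y).

Lemma cplx_mulA : associative cplx_mul.
Proof.
move=> [a b] [c d] [e f]; congr (_, _) => /=.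
  rewrite mulrBr mulrDr mulrBl mulrDl !mulrA !opprD -!addrA; congr (_ + _).
  by rewrite addrA addrC.
rewrite mulrBr mulrDr mulrBl mulrDl !mulrA -!addrA; congr (_ + _).
by rewrite addrA addrC.
Qed.

Lemma cplx_mul1r : left_id (mkcplx 1 0) cplx_mul.
Proof.
by move=> [a b]; congr (_, _); rewrite /= !mul1r !mul0r ?subr0 ?addr0.
Qed.

Lemma cplx_mulr1 : right_id (mkcplx 1 0) cplx_mul.
Proof.
by move=> [a b]; congr (_, _); rewrite /= !mulr1 !mulr0 ?subr0 ?add0r.
Qed.

Lemma cplx_mulDl : left_distributive cplx_mul +%R.
Proof.
move=> [a b] [c d] [e f]; congr (_, _) => /=; rewrite !mulrDl ?opprD.
  exact: addrACA.
exact: addrACA.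
Qed.

Lemma cplx_mulDr : right_distributive cplx_mul +%R.
Proof.
move=> [a b] [c d] [e f]; congr (_, _) => /=; rewrite !mulrDr ?opprD.
  exact: addrACA.
exact: addrACA.
Qed.

Lemma cplx_one_neq0 : mkcplx 1 0 != 0 :> cplx A.
Proof. by apply/eqP => -[] /eqP; rewrite oner_eq0. Qed.

HB.instance Definition _ := GRing.Zmodule_isNzRing.Build (cplx A)
  cplx_mulA cplx_mul1r cplx_mulr1 cplx_mulDl cplx_mulDr cplx_one_neq0.

End CplxRing.

Notation DH R := (dual (quat R)).

Section DualQuaternions.
Variable R : realType.

Definition dh_conj (x : DH R) : DH R :=
  mkdual (quat_conj (dual1 x)) (quat_conj (dual2 x)).

Definition dhc_conj (F : cplx (DH R)) : cplx (DH R) :=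
  mkcplx (dh_conj (cplx0 F)) (dh_conj (cplx1 F)).

Definition sphereDH : set (DH R) :=
  [set J | J + dh_conj J = 0 /\ J * dh_conj J = 1].

Definition dr_to_dh (a : dual R) : DH R := mkdual (dual1 a)%:A (dual2 a)%:A.

Lemma quat_conjK : involutive (@quat_conj R).
Proof. by move=> x; apply: quatP; rewrite /quat_conj !qcoordE ?opprK. Qed.

Lemma quat_conjD : {morph @quat_conj R : x y / x + y}.
Proof.
move=> x y.
by apply: quatP; rewrite qcoordD /quat_conj !qcoordE !qcoordD ?opprD.
Qed.

Lemma quat_conjM (x y : quat R) :
  quat_conj (x * y) = quat_conj y * quat_conj x.
Proof.
rewrite -[RHS]/(quat_mul _ _) -[x * y]/(quat_mul x y).
by apply: quatP; rewrite /quat_conj /quat_mul !qcoordE; ring.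
Qed.

Lemma quat_conj_alg (a : R) : quat_conj a%:A = a%:A.
Proof.
rewrite -[1]/(quat_one R).
by apply: quatP; rewrite /quat_conj !qcoordE !qcoordZ /quat_one !qcoordE; ring.
Qed.

Lemma dh_conjK : involutive dh_conj.
Proof. by case=> a b; rewrite /dh_conj /= !quat_conjK. Qed.

Lemma dh_conjD : {morph dh_conj : x y / x + y}.
Proof. by move=> [a b] [c d]; congr (_, _); exact: quat_conjD. Qed.

Lemma dh_conjM (x y : DH R) : dh_conj (x * y) = dh_conj y * dh_conj x.
Proof.
case: x y => [a b] [c d]; congr (_, _) => /=; first exact: quat_conjM.
by rewrite quat_conjD !quat_conjM addrC.
Qed.

Lemma dh_conj_alg (a : R) : dh_conj (a%:A) = a%:A.
Proof.
congr (_, _); rewrite /=; first exact: quat_conj_alg.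
by rewrite scaler0 -[0](scale0r 1) quat_conj_alg.
Qed.

Lemma dh_conj_dr (a : dual R) : dh_conj (dr_to_dh a) = dr_to_dh a.
Proof. by congr (_, _); exact: quat_conj_alg. Qed.

Lemma dr_to_dhC (a : dual R) (x : DH R) : dr_to_dh a * x = x * dr_to_dh a.
Proof.
case: x => c d; congr (_, _); rewrite /= !mulr_algl !mulr_algr //.
exact: addrC.
Qed.

Lemma sphereDH_conj (J : DH R) : sphereDH J -> sphereDH (dh_conj J).
Proof.
move=> [J0 J1]; split; first by rewrite dh_conjK addrC.
have Jc : dh_conj J = - J by apply/eqP; rewrite -addr_eq0 addrC J0.
by rewrite dh_conjK; move: J1; rewrite Jc mulrN mulNr.
Qed.

End DualQuaternions.

Section SliceFunctions.
Variables (R : realType) (D : set (cplx R)).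

(* The pair (z, J) stands for the point alpha + J beta, z = alpha + e1 beta. *)
Definition Omega : set (DH R) :=
  [set x | exists p : cplx R * DH R, [/\ D p.1, sphereDH p.2 &
     x = (cplx0 p.1)%:A + p.2 * (cplx1 p.1)%:A]].

Lemma OmegaP (x : Omega) : exists p : cplx R * DH R, [/\ D p.1, sphereDH p.2 &
  val x = (cplx0 p.1)%:A + p.2 * (cplx1 p.1)%:A].
Proof. exact: (set_mem (valP x)). Qed.

Definition Omega_repr (x : Omega) : cplx R * DH R := projT1 (cid (OmegaP x)).

Lemma Omega_conj (x : DH R) : Omega x -> Omega (dh_conj x).
Proof.
move=> [[z J] [/= Dz SJ ->]]; exists (z, dh_conj J); split => //=.
  exact: sphereDH_conj.
by rewrite dh_conjD dh_conjM !dh_conj_alg mulr_algl mulr_algr.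
Qed.

Definition conj_Omega (x : Omega) : Omega :=
  SigSub (mem_set (Omega_conj (set_mem (valP x)))).

(* Functions on D are represented by total functions on R_C of which only the
   values on D matter. *)
Definition stem (A : zmodType) (F : cplx R -> cplx A) : Prop :=
  forall z, D z -> F (cplx_bar z) = cplx_bar (F z).

(* Any representation of x gives the same value when F is a stem function. *)
Definition slice_fun (F : cplx R -> cplx (DH R)) : Omega -> DH R := fun x =>
  let: (z, J) := Omega_repr x in cplx0 (F z) + J * cplx1 (F z).

(* Two stem functions inducing the same slice function agree on D, and slice_fun
   only uses values on D, so slice_mul and slice_conj do not depend on the choice
   made by xget. *)
Definition stem_of (f : Omega -> DH R) : cplx R -> cplx (DH R) :=
  xget (fun=> 0) [set F | stem F /\ slice_fun F = f].

Definition slice_mul (f g : Omega -> DH R) : Omega -> DH R :=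
  slice_fun (fun z => stem_of f z * stem_of g z).

Definition slice_conj (f : Omega -> DH R) : Omega -> DH R :=
  slice_fun (fun z => dhc_conj (stem_of f z)).

End SliceFunctions.

Section Regularity.
Variables (R : realType) (D : set (cplx R)) (V : normedModType R).

Definition d_alpha (g : cplx R -> V) (z : cplx R) : V := 'D_(mkcplx 1 0) g z.
Definition d_beta (g : cplx R -> V) (z : cplx R) : V := 'D_(mkcplx 0 1) g z.

Definition continuous_on (g : cplx R -> V) : Prop :=
  forall z, D z -> {for z, continuous g}.

(* Total functions stand for functions on D: the derivatives at points of D only
   depend on the values on D because D is open in all uses. *)
Definition C1_on (g : cplx R -> V) : Prop :=
  [/\ forall z, D z ->
        derivable g z (mkcplx 1 0) /\ derivable g z (mkcplx 0 1),
      continuous_on (d_alpha g) & continuous_on (d_beta g)].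

End Regularity.

Section DualSliceFunctions.
Variables (R : realType) (D : set (cplx R)).
Implicit Types G H : cplx R -> cplx (quat R).

Definition dual_stem G H : cplx R -> cplx (DH R) := fun z =>
  mkcplx (mkdual (cplx0 (G z)) (cplx0 (H z)))
         (mkdual (cplx1 (G z)) (cplx1 (H z))).

Definition S10_data (f : Omega D -> DH R)
    (GH : (cplx R -> cplx (quat R)) * (cplx R -> cplx (quat R))) : Prop :=
  [/\ stem D GH.1, stem D GH.2, C1_on D GH.1, continuous_on D GH.2 &
      f = slice_fun (dual_stem GH.1 GH.2)].

Definition S10 : set (Omega D -> DH R) := [set f | exists GH, S10_data f GH].

(* a + e1 b in DR_C lies in D + eps R_C iff its standard part lies in D. *)
Definition std_part (w : cplx (dual R)) : cplx R :=
  mkcplx (dual1 (cplx0 w)) (dual1 (cplx1 w)).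

Definition Dcheck : set (cplx (dual R)) := [set w | D (std_part w)].

(* The pair (w, J) stands for the point a + J b, w = a + e1 b. *)
Definition Omegacheck : set (DH R) :=
  [set x | exists p : cplx (dual R) * DH R, [/\ Dcheck p.1, sphereDH p.2 &
     x = dr_to_dh (cplx0 p.1) + p.2 * dr_to_dh (cplx1 p.1)]].

Lemma OmegacheckP (x : Omegacheck) :
  exists p : cplx (dual R) * DH R, [/\ Dcheck p.1, sphereDH p.2 &
    val x = dr_to_dh (cplx0 p.1) + p.2 * dr_to_dh (cplx1 p.1)].
Proof. exact: (set_mem (valP x)). Qed.

Definition Omegacheck_repr (x : Omegacheck) : cplx (dual R) * DH R :=
  projT1 (cid (OmegacheckP x)).

Lemma Omegacheck_conj (x : DH R) : Omegacheck x -> Omegacheck (dh_conj x).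
Proof.
move=> [[w J] [/= Dw SJ ->]]; exists (w, dh_conj J); split => //=.
  exact: sphereDH_conj.
by rewrite dh_conjD dh_conjM !dh_conj_dr dr_to_dhC.
Qed.

Definition conj_Omegacheck (x : Omegacheck) : Omegacheck :=
  SigSub (mem_set (Omegacheck_conj (set_mem (valP x)))).

Lemma Omega_sub_check : Omega D `<=` Omegacheck.
Proof.
move=> x [[z J] [/= Dz SJ ->]].
exists (mkcplx (mkdual (cplx0 z) 0) (mkdual (cplx1 z) 0), J); split => //=.
  by case: z Dz.
have drE (a : R) : dr_to_dh (mkdual a 0) = a%:A.
  by congr (_, _); rewrite /= scale0r scaler0.
by rewrite !drE.
Qed.

Definition incl_Omega (x : Omega D) : Omegacheck :=
  SigSub (mem_set (Omega_sub_check (set_mem (valP x)))).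

Definition restr_Omega (g : Omegacheck -> DH R) : Omega D -> DH R :=
  g \o incl_Omega.

(* F_l is G_l + eps H_l. *)
Definition checkF (Gl Hl : cplx R -> quat R) (w : cplx (dual R)) : DH R :=
  let z := std_part w in
  let a2 := dual2 (cplx0 w) in
  let b2 := dual2 (cplx1 w) in
  mkdual (Gl z) (Hl z + a2 *: d_alpha Gl z + b2 *: d_beta Gl z).

(* G and H are determined on D by f, and the value at a + J b does not depend on
   the representation (w, J) of the point. *)
Definition natural_ext (f : Omega D -> DH R) : Omegacheck -> DH R :=
  let: (G, H) := xget ((fun=> 0), (fun=> 0)) (S10_data f) in
  fun x => let: (w, J) := Omegacheck_repr x in
    checkF (fun z => cplx0 (G z)) (fun z => cplx0 (H z)) w +
    J * checkF (fun z => cplx1 (G z)) (fun z => cplx1 (H z)) w.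

Definition DS : set (Omegacheck -> DH R) := natural_ext @` S10.

End DualSliceFunctions.

Arguments S10 {R} D _.
Arguments DS {R} D _.
Arguments natural_ext {R D} f _.
Arguments slice_mul {R D} f g _.
Arguments slice_conj {R D} f _.
Arguments conj_Omega {R D} x.
Arguments conj_Omegacheck {R D} x.

Definition fun_rscale (T : Type) (A : nzRingType) (f : T -> A) (q : A) : T -> A :=
  fun x => f x * q.

(* The records below describe structures carried by a subset M of an ambient
   space.  The operations are total on the ambient space; only their
   restrictions to M matter. *)

Record right_module (A : nzRingType) (V : zmodType) (act : V -> A -> V)
    (M : set V) : Prop := RightModule {
  rmodule_0 : M 0;
  rmodule_D : forall u v, M u -> M v -> M (u + v);
  rmodule_N : forall u, M u -> M (- u);
  rmodule_act : forall u a, M u -> M (act u a);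
  rmodule_actDl : forall u v a, M u -> M v ->
    act (u + v) a = act u a + act v a;
  rmodule_actDr : forall u a b, M u -> act u (a + b) = act u a + act u b;
  rmodule_actA : forall u a b, M u -> act (act u a) b = act u (a * b);
  rmodule_act1 : forall u, M u -> act u 1 = u
}.

Record right_module_iso (A : nzRingType) (V W : zmodType)
    (actV : V -> A -> V) (actW : W -> A -> W) (M : set V) (N : set W)
    (phi : V -> W) : Prop := RightModuleIso {
  rmiso_dom : right_module actV M;
  rmiso_codom : right_module actW N;
  rmiso_bij : set_bij M N phi;
  rmiso_D : forall u v, M u -> M v -> phi (u + v) = phi u + phi v;
  rmiso_act : forall u a, M u -> phi (actV u a) = actW (phi u) a
}.

Record star_algebra (K : comNzRingType) (V : lmodType K) (M : set V)
    (mul : V -> V -> V) (conj : V -> V) : Prop := StarAlgebra {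
  salg_0 : M 0;
  salg_D : forall u v, M u -> M v -> M (u + v);
  salg_Z : forall (k : K) u, M u -> M (k *: u);
  salg_mul : forall u v, M u -> M v -> M (mul u v);
  salg_mulA : forall u v w, M u -> M v -> M w ->
    mul u (mul v w) = mul (mul u v) w;
  salg_mulDl : forall u v w, M u -> M v -> M w ->
    mul (u + v) w = mul u w + mul v w;
  salg_mulDr : forall u v w, M u -> M v -> M w ->
    mul u (v + w) = mul u v + mul u w;
  salg_mulZl : forall (k : K) u v, M u -> M v -> mul (k *: u) v = k *: mul u v;
  salg_mulZr : forall (k : K) u v, M u -> M v -> mul u (k *: v) = k *: mul u v;
  salg_one : exists2 e, M e & forall u, M u -> mul e u = u /\ mul u e = u;
  salg_conj : forall u, M u -> M (conj u);
  salg_conjD : forall u v, M u -> M v -> conj (u + v) = conj u + conj v;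
  salg_conjZ : forall (k : K) u, M u -> conj (k *: u) = k *: conj u;
  salg_conjM : forall u v, M u -> M v -> conj (mul u v) = mul (conj v) (conj u);
  salg_conjK : forall u, M u -> conj (conj u) = u
}.

Record star_algebra_iso (K : comNzRingType) (V W : lmodType K)
    (M : set V) (mulV : V -> V -> V) (conjV : V -> V)
    (N : set W) (mulW : W -> W -> W) (conjW : W -> W)
    (phi : V -> W) : Prop := StarAlgebraIso {
  saiso_dom : star_algebra M mulV conjV;
  saiso_codom : star_algebra N mulW conjW;
  saiso_bij : set_bij M N phi;
  saiso_D : forall u v, M u -> M v -> phi (u + v) = phi u + phi v;
  saiso_Z : forall (k : K) u, M u -> phi (k *: u) = k *: phi u;
  saiso_M : forall u v, M u -> M v -> phi (mulV u v) = mulW (phi u) (phi v);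
  saiso_conj : forall u, M u -> phi (conjV u) = conjW (phi u)
}.

(* Main.v *)
Require Import Defs.
From HB Require Import structures.
From mathcomp Require Import all_boot all_order all_algebra.
From mathcomp Require Import ring lra.
From mathcomp Require Import all_classical all_reals all_analysis.
Import Order.TTheory GRing.Theory Num.Theory numFieldNormedType.Exports.
Local Open Scope classical_set_scope.
Local Open Scope ring_scope.
Set Implicit Arguments.
Unset Strict Implicit.
Unset Printing Implicit Defensive.

(** A slice function is determined by its stem function, so every operation on
    slice functions can be computed on stem functions.  For J in the sphere
    S_DH, the values of I(F) at alpha + J beta and alpha - J beta are F_0 + J F_1
    and F_0 - J F_1, which determine F_0 and F_1 ([slice_fun_inj]); sums, products,
    conjugates and right multiples of slice functions are therefore induced by
    the corresponding expressions in the stem functions, and the axioms of a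
    star-algebra are those of the complexified dual quaternions.

    Natural extension is well defined because a point a + I b has few
    representations ([slice_point_inj]): the trace x + x^c recovers a, the
    square of I b recovers b^2, and when the standard part of b is nonzero this
    leaves only (b, I) and (-b, -I).  These two agree because the partial
    derivatives of a stem function inherit its symmetry: the alpha-derivative is
    again a stem function, and the beta-derivative is one up to sign.  When the
    standard part of b vanishes, the same symmetry at the real point kills G_1,
    H_1, the alpha-derivative of G_1 and the beta-derivative of G_0, so the
    value depends on I and b only through I b ([eval_check_stem]).

    Once the value of an extension may be computed from any stem data and any
    representation ([natural_ext_at]), additivity, right linearity and
    compatibility with x |-> x^c follow from the linearity of partial
    derivatives, and restriction undoes extension because the dual parts of the
    coordinates are zero on Omega_D.  The algebra structure on dual slice
    functions is transported along this bijection ([star_algebra_transport]),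
    which leaves no other choice.

    The analytic content is that the functions with G of class C^1 and H
    continuous are closed under product.  The product of (G, H) and (G', H') has
    second component G H' + H G', so a C^1 function must be shown to be
    continuous; since C^1 only speaks of partial derivatives, this is the mean
    value theorem along a horizontal and a vertical segment
    ([C1_on_plane_continuous]).  Everything else reduces to real-valued
    functions by writing a quaternionic function in coordinates. *)

(** * Partial derivatives on an open set of the plane *)

Section DirectionalDerivatives.
Variable R : realType.
Implicit Types U V W : normedModType R.

Lemma linear_subZ V W (L : V -> W) (k : R) x y :
  linear L -> L (k *: (x - y)) = k *: (L x - L y).
Proof.
move=> linL.
have L0 : L 0 = 0.
  by have := linL (-1) 0 0; rewrite scaler0 addr0 scaleN1r addNr.
have LZ a u : L (a *: u) = a *: L u by rewrite -[a *: u]addr0 linL L0 addr0.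
by rewrite LZ -[x - y]addrC -scaleN1r linL scaleN1r addrC.
Qed.

Lemma is_derive_linear U V W (L : V -> W) (f : U -> V) (x v : U) :
  linear L -> continuous L -> derivable f x v ->
  is_derive x v (L \o f) (L ('D_v f x)).
Proof.
move=> linL contL df.
have cvL : (fun h => h^-1 *: (((L \o f) \o shift x) (h *: v) - (L \o f) x))
    @ 0^' --> L ('D_v f x).
  rewrite (_ : (fun h => _) =
      L \o (fun h => h^-1 *: ((f \o shift x) (h *: v) - f x))); last first.
    by apply/funext => h /=; rewrite linear_subZ.
  by apply: continuous_cvg; [exact: contL|exact: df].
by split; [apply/cvg_ex; exists (L ('D_v f x))|exact: cvg_lim cvL].
Qed.

(** Used with a reflection of the plane, and with the parametrization of a line. *)
Lemma derive_comp_affine U U' V (s : U -> U') (f : U' -> V) x v v' :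
  (forall h : R, s (h *: v + x) = h *: v' + s x) ->
  'D_v (f \o s) x = 'D_v' f (s x).
Proof.
move=> sE; rewrite /derive.
suff -> : (fun h => h^-1 *: (((f \o s) \o shift x) (h *: v) - (f \o s) x)) =
    (fun h => h^-1 *: ((f \o shift (s x)) (h *: v') - f (s x))) by [].
by apply/funext => h /=; rewrite sE.
Qed.

(** Only the derivative along v is assumed, so f restricted to the line is
    differentiated as a function of one real variable, where it is linear in the
    direction. *)
Lemma derive_oppv U V (f : U -> V) (x v : U) :
  derivable f x v -> 'D_(- v) f x = - 'D_v f x.
Proof.
move=> /derivable1P /derivable1_diffP; set phi := fun h : R => _ => dphi.
have line (v' : U) (c : R) : (forall h : R, h *: (c *: v) = h *: v') ->
    'D_c phi 0 = 'D_v' f x.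
  move=> E; rewrite -[x in RHS]add0r -[0 in RHS](scale0r v).
  apply: (@derive_comp_affine _ _ _ (fun h : R => h *: v + x)) => h.
  by rewrite addr0 scale0r add0r -E scalerA.
rewrite -(line v 1) => [|h]; last by rewrite scale1r.
rewrite -(line (- v) (-1)) => [|h]; last by rewrite scaleN1r.
by rewrite !deriveE // linearN.
Qed.

End DirectionalDerivatives.

Section Segments.
Variable R : realType.

(** The mean value inequality, on the segment joining two points of a ball. *)
Lemma segment_bound (phi dphi : R -> R) (c e M u v : R) :
  (forall t, ball c e t -> is_derive t 1 phi (dphi t) /\ `|dphi t| <= M) ->
  ball c e u -> ball c e v -> `|phi u - phi v| <= M * `|u - v|.
Proof.
move=> dphiP; wlog uv : u v / u <= v.
  move=> H cu cv; have [uv|/ltW vu] := leP u v; first exact: H.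
  by rewrite distrC [`|u - v|]distrC; apply: H.
move=> cu cv.
have inball t : t \in `[u, v]%R -> ball c e t.
  rewrite in_itv /= => /andP[ut tv].
  move: cu cv; rewrite -ball_normE /= !ltr_distlC => /andP[cu _] /andP[_ cv].
  by rewrite (lt_le_trans cu ut) (le_lt_trans tv cv).
have [t tuv phiE] : exists2 t, t \in `[u, v]%R &
    phi v - phi u = dphi t * (v - u).
  apply: MVT_segment => //.
    by move=> t /subset_itv_oo_cc /inball /dphiP [].
  by apply: derivable_within_continuous => t /inball /dphiP [].
rewrite distrC phiE normrM [`|u - v|]distrC ler_wpM2r //.
by have [] := dphiP _ (inball _ tuv).
Qed.

Variable V : normedModType R.

Lemma is_derive_horizontal (f : cplx R -> V) (s t : R) df :
  is_derive (mkcplx t s) (mkcplx 1 0) f df ->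
  is_derive t 1 (fun t => f (mkcplx t s)) df.
Proof.
have E : (fun h => h^-1 *: (((fun t => f (mkcplx t s)) \o shift t) (h *: 1)
    - f (mkcplx t s))) =
  (fun h => h^-1 *: ((f \o shift (mkcplx t s)) (h *: mkcplx 1 0)
    - f (mkcplx t s))).
  apply/funext => h /=; congr (_ *: (f _ - _)); congr (_, _).
  by rewrite /= scaler0 add0r.
by case; rewrite /derivable /derive -E => ? ?; split.
Qed.

Lemma is_derive_vertical (f : cplx R -> V) (s t : R) df :
  is_derive (mkcplx s t) (mkcplx 0 1) f df ->
  is_derive t 1 (fun t => f (mkcplx s t)) df.
Proof.
have E : (fun h => h^-1 *: (((fun t => f (mkcplx s t)) \o shift t) (h *: 1)
    - f (mkcplx s t))) =
  (fun h => h^-1 *: ((f \o shift (mkcplx s t)) (h *: mkcplx 0 1)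
    - f (mkcplx s t))).
  apply/funext => h /=; congr (_ *: (f _ - _)); congr (_, _).
  by rewrite /= scaler0 add0r.
by case; rewrite /derivable /derive -E => ? ?; split.
Qed.

End Segments.

Section PlaneRegularity.
Variables (R : realType) (D : set (cplx R)).
Hypothesis hD : open D.

Lemma near_in_domain z : D z -> \forall y \near z, D y.
Proof. by move=> Dz; exact: (open_nbhs_nbhs (conj hD Dz)). Qed.

Section VectorValued.
Variable V : normedModType R.
Implicit Types f g : cplx R -> V.

Lemma eq_continuous_on f g :
  (forall z, D z -> f z = g z) -> continuous_on D f -> continuous_on D g.
Proof.
move=> fg cf z Dz.
have cfz : f @ z --> g z by rewrite -(fg z Dz); exact: cf.
apply: cvg_trans cfz; apply: near_eq_cvg.
by apply: filterS (near_in_domain Dz) => y Dy; exact: fg.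
Qed.

(** Because D is open, partial derivatives on D see only the values on D. *)
Lemma eq_d_alpha f g :
  (forall z, D z -> f z = g z) -> forall z, D z -> d_alpha f z = d_alpha g z.
Proof.
move=> fg z Dz; apply: near_eq_derive.
by apply: filterS (near_in_domain Dz) => y Dy; exact: fg.
Qed.

Lemma eq_d_beta f g :
  (forall z, D z -> f z = g z) -> forall z, D z -> d_beta f z = d_beta g z.
Proof.
move=> fg z Dz; apply: near_eq_derive.
by apply: filterS (near_in_domain Dz) => y Dy; exact: fg.
Qed.

(** The partial derivatives may be replaced by any functions agreeing with them
    on D, which lets each closure property exhibit its own formula. *)
Lemma C1_on_partials f fa fb :
  (forall z, D z -> is_derive z (mkcplx 1 0) f (fa z)) ->
  (forall z, D z -> is_derive z (mkcplx 0 1) f (fb z)) ->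
  continuous_on D fa -> continuous_on D fb -> C1_on D f.
Proof.
move=> da db ca cb; split.
- by move=> z Dz; split; [have [] := da z Dz|have [] := db z Dz].
- by apply: eq_continuous_on ca => z Dz; have [_ <-] := da z Dz.
- by apply: eq_continuous_on cb => z Dz; have [_ <-] := db z Dz.
Qed.

Lemma C1_on_derive f : C1_on D f -> forall z, D z ->
  is_derive z (mkcplx 1 0) f (d_alpha f z) /\
  is_derive z (mkcplx 0 1) f (d_beta f z).
Proof. by case=> df _ _ z /df [da db]; split; apply: derivableP. Qed.

Lemma continuous_onD f g :
  continuous_on D f -> continuous_on D g -> continuous_on D (f \+ g).
Proof. by move=> cf cg z Dz; apply: continuousD; [exact: cf|exact: cg]. Qed.

Lemma C1_onD f g : C1_on D f -> C1_on D g -> C1_on D (f \+ g).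
Proof.
move=> Cf Cg; have [_ fa fb] := Cf; have [_ ga gb] := Cg.
apply: (C1_on_partials (fa := d_alpha f \+ d_alpha g)
                       (fb := d_beta f \+ d_beta g)).
- move=> z Dz; have [? _] := C1_on_derive Cf Dz.
  have [? _] := C1_on_derive Cg Dz.
  exact: is_deriveD.
- move=> z Dz; have [_ ?] := C1_on_derive Cf Dz.
  have [_ ?] := C1_on_derive Cg Dz.
  exact: is_deriveD.
- exact: continuous_onD.
- exact: continuous_onD.
Qed.

Lemma C1_on_cst (c : V) : C1_on D (fun=> c).
Proof.
apply: (C1_on_partials (fa := fun=> 0) (fb := fun=> 0)) => z Dz.
- exact: cst_continuous.
- exact: cst_continuous.
Qed.

Lemma C1_on_sum (I : Type) (r : seq I) (F : I -> cplx R -> V) :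
  (forall i, C1_on D (F i)) -> C1_on D (fun z => \sum_(i <- r) F i z).
Proof.
move=> CF; elim: r => [|i r IH].
  rewrite (_ : (fun z => _) = fun=> 0); first exact: C1_on_cst.
  by apply/funext => z; rewrite big_nil.
rewrite (_ : (fun z => _) = F i \+ (fun z => \sum_(i <- r) F i z)).
  exact: C1_onD.
by apply/funext => z; rewrite big_cons.
Qed.

Lemma continuous_on_sum (I : Type) (r : seq I) (F : I -> cplx R -> V) :
  (forall i, continuous_on D (F i)) ->
  continuous_on D (fun z => \sum_(i <- r) F i z).
Proof.
by move=> cF z Dz; apply: cvg_big => [|i _]; [exact: add_continuous|exact: cF].
Qed.

End VectorValued.

Section LinearImage.
Variables V W : normedModType R.
Implicit Types f : cplx R -> V.

Lemma continuous_on_linear (L : V -> W) f :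
  continuous L -> continuous_on D f -> continuous_on D (L \o f).
Proof. by move=> cL cf z Dz; apply: continuous_comp (cf z Dz) (cL _). Qed.

Lemma C1_on_linear (L : V -> W) f : linear L -> continuous L ->
  C1_on D f -> C1_on D (L \o f).
Proof.
move=> linL cL Cf; have [_ fa fb] := Cf.
apply: (C1_on_partials (fa := L \o d_alpha f) (fb := L \o d_beta f)).
- by move=> z Dz; have [? _] := C1_on_derive Cf Dz; apply: is_derive_linear.
- by move=> z Dz; have [_ ?] := C1_on_derive Cf Dz; apply: is_derive_linear.
- exact: continuous_on_linear.
- exact: continuous_on_linear.
Qed.

End LinearImage.

Section RealValued.
Implicit Types f g : cplx R -> R.

Lemma continuous_onM f g :
  continuous_on D f -> continuous_on D g -> continuous_on D (f \* g).
Proof. by move=> cf cg z Dz; apply: continuousM; [exact: cf|exact: cg]. Qed.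

(** Near z both partial derivatives are bounded by some M, so moving from z
    first vertically, then horizontally, changes f by at most M times the l1
    distance. *)
Lemma C1_on_plane_continuous f : C1_on D f -> continuous_on D f.
Proof.
move=> Cf z Dz.
have [_ cfa cfb] := Cf.
(* The summand 1 makes M strictly larger than both derivatives at z, hence a
   bound for them nearby. *)
pose M := `|d_alpha f z| + `|d_beta f z| + 1.
have M0 : 0 < M by rewrite ltr_wpDl// addr_ge0.
have near_alpha : \forall y \near z, `|d_alpha f z - d_alpha f y| < 1.
  by have /cvgrPdist_lt /(_ _ ltr01) := cfa z Dz.
have near_beta : \forall y \near z, `|d_beta f z - d_beta f y| < 1.
  by have /cvgrPdist_lt /(_ _ ltr01) := cfb z Dz.
have near_bound : \forall y \near z,
    [/\ D y, `|d_alpha f y| <= M & `|d_beta f y| <= M].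
  have tri (w w' : R) : `|w - w'| < 1 -> `|w'| <= `|w| + 1.
    move=> ww'; rewrite -lerBlDl; apply: le_trans (lerB_dist _ _) _.
    by rewrite distrC ltW.
  apply: filterS3 (near_in_domain Dz) near_alpha near_beta.
  move=> y Dy /tri ya /tri yb.
  split; [exact: Dy|apply: le_trans ya _|apply: le_trans yb _].
  - by rewrite lerD2r lerDl.
  - by rewrite lerD2r lerDr.
have [e /= e0 eball] : exists2 e : R, 0 < e & forall y, ball z e y ->
    [/\ D y, `|d_alpha f y| <= M & `|d_beta f y| <= M].
  by move/nbhs_ballP: near_bound => [e /= e0 He]; exists e.
have lip y : ball z e y ->
    `|f z - f y| <= M * (`|cplx0 z - cplx0 y| + `|cplx1 z - cplx1 y|).
  case: y => y0 y1 [/= zy1 zy2]; rewrite -[(y0, y1)]/(mkcplx y0 y1).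
  rewrite (_ : f z - f (mkcplx y0 y1) = (f z - f (mkcplx (cplx0 z) y1)) +
      (f (mkcplx (cplx0 z) y1) - f (mkcplx y0 y1))); last first.
    by rewrite addrA subrK.
  apply: le_trans (ler_normD _ _) _; rewrite addrC mulrDr; apply: lerD.
  - apply: (segment_bound (c := cplx0 z) (e := e)
        (phi := fun t => f (mkcplx t y1))
        (dphi := fun t => d_alpha f (mkcplx t y1)));
      [|exact: ballxx|exact: zy1].
    move=> t zt; have [Dt Mt _] := eball (mkcplx t y1) (conj zt zy2).
    by split; [|exact: Mt]; apply: is_derive_horizontal;
      have [] := C1_on_derive Cf Dt.
  - have fzE : f z = f (mkcplx (cplx0 z) (cplx1 z)) by case: (z).
    rewrite fzE.
    apply: (segment_bound (c := cplx1 z) (e := e)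
        (phi := fun t => f (mkcplx (cplx0 z) t))
        (dphi := fun t => d_beta f (mkcplx (cplx0 z) t)));
      [|exact: ballxx|exact: zy2].
    move=> t zt; have [Dt _ Mt] :=
      eball (mkcplx (cplx0 z) t) (conj (ballxx _ e0) zt).
    by split; [|exact: Mt]; apply: is_derive_vertical;
      have [] := C1_on_derive Cf Dt.
apply/cvgrPdist_le => eps eps0.
have d0 : 0 < eps / (2 * M) by rewrite divr_gt0 ?mulr_gt0.
near=> y.
have zy : ball z e y by near: y; apply: (nbhsx_ballx z e e0).
have [/= zy1 zy2] : ball z (eps / (2 * M)) y.
  by near: y; exact: (nbhsx_ballx z _ d0).
apply: le_trans (lip y zy) _.
rewrite mulrC -ler_pdivlMr// (_ : eps / M = eps / (2 * M) + eps / (2 * M)).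
  by apply: lerD; apply: ltW.
by field; rewrite gt_eqF.
Unshelve. all: by end_near. Qed.

Lemma C1_onM f g : C1_on D f -> C1_on D g -> C1_on D (f \* g).
Proof.
move=> Cf Cg; have [_ fa fb] := Cf; have [_ ga gb] := Cg.
have cf := C1_on_plane_continuous Cf; have cg := C1_on_plane_continuous Cg.
apply: (C1_on_partials (fa := (f \* d_alpha g) \+ (g \* d_alpha f))
               (fb := (f \* d_beta g) \+ (g \* d_beta f))).
- move=> z Dz; have [? _] := C1_on_derive Cf Dz.
  have [? _] := C1_on_derive Cg Dz.
  exact: is_deriveM.
- move=> z Dz; have [_ ?] := C1_on_derive Cf Dz.
  have [_ ?] := C1_on_derive Cg Dz.
  exact: is_deriveM.
- by apply: continuous_onD; apply: continuous_onM.
- by apply: continuous_onD; apply: continuous_onM.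
Qed.

End RealValued.
End PlaneRegularity.

(** * Complexified quaternions in real coordinates *)

Section CplxScale.
Variables (K : pzRingType) (A : algType K).
Implicit Types x y : cplx A.

(** The ascription matters: without it the product would be that of A * A,
    componentwise. *)
Lemma cplx_scaleAl (k : K) x y : k *: (x * y) = (k *: x : cplx A) * y.
Proof.
rewrite -[RHS]/(cplx_mul _ _) -[x * y]/(cplx_mul x y).
case: x y => [a b] [c d]; congr (_, _) => /=.
  by rewrite scalerBr !scalerAl.
by rewrite scalerDr !scalerAl.
Qed.

Lemma cplx_scaleAr (k : K) x y : k *: (x * y) = x * (k *: y : cplx A).
Proof.
rewrite -[RHS]/(cplx_mul _ _) -[x * y]/(cplx_mul x y).
case: x y => [a b] [c d]; congr (_, _) => /=.
  by rewrite scalerBr !scalerAr.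
by rewrite scalerDr !scalerAr.
Qed.

End CplxScale.

Section Coordinates.
Variable R : realType.
Local Notation CH := (cplx (quat R)).

Definition cq_basis (k : bool * 'I_4) : CH :=
  if k.1 then mkcplx 0 (delta_mx 0 k.2) else mkcplx (delta_mx 0 k.2) 0.

Definition cq_coord (k : bool * 'I_4) (x : CH) : R :=
  (if k.1 then cplx1 x else cplx0 x) 0 k.2.

Lemma cq_expand x : x = \sum_k cq_coord k x *: cq_basis k.
Proof.
rewrite -(pair_bigA _ (fun b i => cq_coord (b, i) x *: cq_basis (b, i))) /=.
rewrite big_bool /=.
have pE (I : finType) (F : I -> CH) :
    \sum_i F i = (\sum_i (F i).1, \sum_i (F i).2).
  by apply: (big_rec3 (fun (a : CH) b c => a = (b, c))) => // i a b c _ ->.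
rewrite !pE /cq_basis /cq_coord /=; case: x => a b /=.
have z0 (c : 'rV[R]_4) : \sum_(i < 4) c 0 i *: (0 : quat R) = 0.
  by rewrite big1 // => i _; exact: scaler0.
by congr (_, _) => /=; rewrite z0 ?add0r ?addr0; exact: row_sum_delta.
Qed.

Lemma linear_cq_coord k : linear (cq_coord k).
Proof. by case: k => [[] i] a x y; rewrite /cq_coord /= !mxE. Qed.

Lemma continuous_cq_coord k : continuous (cq_coord k).
Proof.
case: k => [[] i] x; rewrite /cq_coord /=.
  apply: (@continuous_comp _ _ _ snd (fun y : 'rV[R]_4 => y 0 i)).
    exact: cvg_snd.
  exact: coord_continuous.
apply: (@continuous_comp _ _ _ fst (fun y : 'rV[R]_4 => y 0 i)).
  exact: cvg_fst.
exact: coord_continuous.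
Qed.

Lemma linear_cq_expand (W : normedModType R) (L : CH -> W) x :
  linear L -> L x = \sum_k cq_coord k x *: L (cq_basis k).
Proof.
move=> linL.
pose L' : {linear CH -> W} := HB.pack L (GRing.isLinear.Build _ _ _ _ L linL).
rewrite -[L]/(L' : _ -> _) {1}(cq_expand x) linear_sum.
by apply: eq_bigr => k _; rewrite linearZ.
Qed.

(** Coordinates are continuous, and a linear map is a combination of them with
    fixed vector coefficients. *)
Lemma cq_linear_continuous (W : normedModType R) (L : CH -> W) :
  linear L -> continuous L.
Proof.
move=> linL x.
rewrite (_ : L = fun y => \sum_k cq_coord k y *: L (cq_basis k)); last first.
  by apply/funext => y; exact: linear_cq_expand.
apply: cvg_big => [|k _]; first exact: add_continuous.
by apply: cvgZr_tmp; exact: continuous_cq_coord.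
Qed.

(** Writes a product as a bilinear expression in real coordinates, so that its
    regularity follows from that of products of real functions. *)
Lemma cq_mul_expand x y : x * y =
  \sum_i \sum_j (cq_coord i x * cq_coord j y) *: (cq_basis i * cq_basis j).
Proof.
rewrite {1}(cq_expand x) {1}(cq_expand y) mulr_suml; apply: eq_bigr => i _.
rewrite mulr_sumr; apply: eq_bigr => j _.
by rewrite -cplx_scaleAl -cplx_scaleAr scalerA.
Qed.

End Coordinates.

Section QuaternionRegularity.
Variables (R : realType) (D : set (cplx R)).
Hypothesis hD : open D.
Local Notation CH := (cplx (quat R)).
Implicit Types G H : cplx R -> CH.

Lemma linear_scalel (V : normedModType R) (v : V) :
  linear (fun k : R => k *: v).
Proof. by move=> a k l; rewrite scalerDl -scalerA. Qed.

Lemma C1_on_cq_coord G k : C1_on D G -> C1_on D (fun z => cq_coord k (G z)).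
Proof.
exact: (C1_on_linear hD (@linear_cq_coord R k) (@continuous_cq_coord R k)).
Qed.

Lemma continuous_on_mul G H : continuous_on D G -> continuous_on D H ->
  continuous_on D (fun z => G z * H z).
Proof.
move=> cG cH.
rewrite (_ : (fun z => _) = fun z => \sum_i \sum_j
    (cq_coord i (G z) * cq_coord j (H z)) *: (cq_basis R i * cq_basis R j)).
  apply: continuous_on_sum => i; apply: continuous_on_sum => j.
  apply: (continuous_on_linear (@scalel_continuous _ _ _)).
  by apply: continuous_onM; apply: continuous_on_linear => //;
    exact: continuous_cq_coord.
by apply/funext => z; exact: cq_mul_expand.
Qed.

Lemma C1_on_continuous G : C1_on D G -> continuous_on D G.
Proof.
move=> CG.
rewrite (_ : G = fun z => \sum_k cq_coord k (G z) *: cq_basis R k).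
  apply: continuous_on_sum => k.
  apply: (continuous_on_linear (@scalel_continuous _ _ _)).
  by apply: (C1_on_plane_continuous hD); exact: C1_on_cq_coord.
by apply/funext => z; exact: cq_expand.
Qed.

Lemma C1_on_mul G H : C1_on D G -> C1_on D H -> C1_on D (fun z => G z * H z).
Proof.
move=> CG CH.
rewrite (_ : (fun z => _) = fun z => \sum_i \sum_j
    (cq_coord i (G z) * cq_coord j (H z)) *: (cq_basis R i * cq_basis R j)).
  apply: (C1_on_sum hD) => i; apply: (C1_on_sum hD) => j.
  apply: (C1_on_linear hD (@linear_scalel _ _) (@scalel_continuous _ _ _)).
  by apply: C1_onM => //; exact: C1_on_cq_coord.
by apply/funext => z; exact: cq_mul_expand.
Qed.

End QuaternionRegularity.

(** * Imaginary units of the dual quaternions *)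

Lemma cplxP (A : Type) (x y : cplx A) :
  cplx0 x = cplx0 y -> cplx1 x = cplx1 y -> x = y.
Proof. by case: x y => [a b] [c d] /= -> ->. Qed.

Lemma dualP (A : Type) (x y : dual A) :
  dual1 x = dual1 y -> dual2 x = dual2 y -> x = y.
Proof. by case: x y => [a b] [c d] /= -> ->. Qed.

Section CplxBar.
Variable A : nzRingType.
Implicit Types x y : cplx A.

Lemma cplx_barD x y : cplx_bar (x + y) = cplx_bar x + cplx_bar y.
Proof. by apply: cplxP; rewrite //= opprD. Qed.

Lemma cplx_barM x y : cplx_bar (x * y) = cplx_bar x * cplx_bar y.
Proof.
rewrite -[RHS]/(cplx_mul _ _) -[x * y]/(cplx_mul x y).
by apply: cplxP => /=; rewrite ?mulrNN // mulrN mulNr opprD.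
Qed.

End CplxBar.

Lemma linear_cplx_bar (K : pzRingType) (V : lmodType K) : linear (@cplx_bar V).
Proof. by move=> k x y; apply: cplxP => //=; rewrite scalerN opprD. Qed.

Lemma eq_opp0 (K : numFieldType) (V : lmodType K) (x : V) : x = - x -> x = 0.
Proof.
move=> xN; have /eqP : 2%:R *: x = 0.
  by rewrite scaler_nat mulr2n {1}xN addNr.
by rewrite scaler_eq0 pnatr_eq0 /= => /eqP.
Qed.

Section Sphere.
Variable R : realType.
Implicit Types (J : DH R) (a b : dual R).

Lemma sphere_conj J : sphereDH J -> dh_conj J = - J.
Proof. by case=> J0 _; apply/eqP; rewrite -addr_eq0 addrC J0. Qed.

Lemma sphere_sqr J : sphereDH J -> J * J = -1.
Proof.
move=> SJ; have [_ J1] := SJ; move: J1.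
by rewrite (sphere_conj SJ) mulrN => <-; rewrite opprK.
Qed.

Lemma sphereN J : sphereDH J -> sphereDH (- J).
Proof. by move=> SJ; rewrite -(sphere_conj SJ); exact: sphereDH_conj. Qed.

Lemma sphere_lreg J x y : sphereDH J -> J * x = J * y -> x = y :> DH R.
Proof.
move=> SJ /(congr1 (fun u => J * u)).
by rewrite !mulrA sphere_sqr // !mulN1r => /oppr_inj.
Qed.

Lemma sphere_inhabited : exists J : DH R, sphereDH J.
Proof.
exists (mkdual (mkquat 0 1 0 0) 0); split.
  apply: dualP => /=; apply: quatP;
    by rewrite /quat_conj ?qcoordD ?qcoordE /qcoord !mxE; ring.
have -> : dh_conj (mkdual (mkquat 0 1 0 0) 0) =
    mkdual (- mkquat 0 1 0 0) 0 :> DH R.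
  apply: dualP => /=; apply: quatP;
    by rewrite /quat_conj ?qcoordE /qcoord !mxE ?inordK //=; ring.
apply: dualP => /=; last by rewrite mulr0 mul0r addr0.
rewrite mulrN -[RHS]/(quat_one R) -[mkquat _ _ _ _ * _]/(quat_mul _ _).
apply: quatP; rewrite /qcoord mxE -/(qcoord _ _) /quat_mul /quat_one ?qcoordE;
  by rewrite /qcoord ?mxE ?inordK //=; ring.
Qed.

Definition eval_at J (F : cplx (DH R)) : DH R := cplx0 F + J * cplx1 F.

Lemma eval_atD J F F' : eval_at J (F + F') = eval_at J F + eval_at J F'.
Proof. by rewrite /eval_at /= mulrDr addrACA. Qed.

(** The pairs (z, J) and (bar z, -J) represent the same point; this is why stem
    functions induce functions of the point. *)
Lemma eval_at_bar J F : eval_at (- J) (cplx_bar F) = eval_at J F.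
Proof. by rewrite /eval_at /= mulrNN. Qed.

Lemma eval_at_mulr J (F : cplx (DH R)) q :
  eval_at J (F * mkcplx q 0) = eval_at J F * q.
Proof.
rewrite /eval_at -[F * _]/(cplx_mul F _) /= !mulr0 subr0 add0r.
by rewrite mulrDl mulrA.
Qed.

Lemma dr_to_dhD a b : dr_to_dh (a + b) = dr_to_dh a + dr_to_dh b.
Proof. by apply: dualP; rewrite /= scalerDl. Qed.

Lemma alg_quat_inj (r s : R) : r%:A = s%:A :> quat R -> r = s.
Proof. exact: (fmorph_inj (GRing.in_alg (quat R))). Qed.

Lemma dr_to_dh_inj : injective (@dr_to_dh R).
Proof.
by move=> [a b] [c d] [/alg_quat_inj ac /alg_quat_inj bd]; rewrite /= ac bd.
Qed.

Lemma mul_dr J b : J * dr_to_dh b =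
  mkdual (dual1 b *: dual1 J) (dual2 b *: dual1 J + dual1 b *: dual2 J).
Proof. by apply: dualP; rewrite /= !mulr_algr. Qed.

Definition slice_point (w : cplx (dual R)) J : DH R :=
  dr_to_dh (cplx0 w) + J * dr_to_dh (cplx1 w).

Lemma conj_slice_point w J : sphereDH J ->
  dh_conj (slice_point w J) = slice_point w (- J).
Proof.
move=> SJ; rewrite /slice_point dh_conjD dh_conjM !dh_conj_dr dr_to_dhC.
by rewrite sphere_conj.
Qed.

(** The three cases: same representation, conjugate representation, and the
    degenerate points whose b is a multiple of eps.  In the last case J is
    determined only through the product of its standard part with b_2. *)
Lemma slice_point_inj w w' J J' : sphereDH J -> sphereDH J' ->
  slice_point w J = slice_point w' J' ->
  [\/ w' = w /\ J' = J, w' = cplx_bar w /\ J' = - J |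
      [/\ cplx0 w' = cplx0 w, dual1 (cplx1 w) = 0, dual1 (cplx1 w') = 0 &
          dual2 (cplx1 w) *: dual1 J = dual2 (cplx1 w') *: dual1 J']].
Proof.
case: w w' => [a b] [a' b'] SJ SJ' E.
have Ea : a = a'.
  have /eqP := congr1 (fun x => x + dh_conj x) E.
  rewrite !conj_slice_point // /slice_point /= !mulNr.
  rewrite addrACA subrr [X in _ == X]addrACA subrr !addr0 -!dr_to_dhD.
  move=> /eqP /dr_to_dh_inj aa.
  case: a a' aa {E} => [a1 a2] [a1' a2'] [aa1 aa2].
  by congr (_, _); lra.
subst a'; move: E => /addrI /=; rewrite !mul_dr => Eb.
have [E1 E2] : dual1 b *: dual1 J = dual1 b' *: dual1 J' /\
    dual2 b *: dual1 J + dual1 b *: dual2 J =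
    dual2 b' *: dual1 J' + dual1 b' *: dual2 J' by case: Eb.
(* J and J' both square to -1, so squaring J b = J' b' eliminates them. *)
have sqE : b * b = b' * b'.
  have sq (I : DH R) c : sphereDH I ->
      (I * dr_to_dh c) * (I * dr_to_dh c) = - dr_to_dh (c * c).
    move=> SI; rewrite -mulrA [dr_to_dh c * _]mulrA dr_to_dhC -mulrA mulrA.
    rewrite sphere_sqr // mulN1r; congr (- _); apply: dualP => /=.
      by rewrite mulr_algl scalerA.
    by rewrite !mulr_algl !scalerA -scalerDl.
  have := sq _ b SJ; rewrite !mul_dr Eb -!mul_dr sq //.
  by move=> /oppr_inj /dr_to_dh_inj.
case: b b' E1 E2 sqE {Eb} => [b1 b2] [c1 c2] /= E1 E2 [sq1 sq2].
have [b10|b1n0] := eqVneq b1 0.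
  apply: Or33; split => //=; rewrite b10 in E1 E2 sq1.
    by move/eqP: sq1; rewrite mul0r eq_sym mulf_eq0 orbb => /eqP.
  have c10 : c1 = 0.
    by move/eqP: sq1; rewrite mul0r eq_sym mulf_eq0 orbb => /eqP.
  by move: E2; rewrite c10 !scale0r !addr0.
have /orP[/eqP c1E|/eqP c1E] : (c1 == b1) || (c1 == - b1).
- by rewrite -eqf_sqr !expr2 sq1.
- subst c1; apply: Or31.
  have b2E : c2 = b2.
    by apply: (mulfI b1n0); lra.
  rewrite b2E; split => //; apply: dualP.
    by apply: (scalerI b1n0).
  apply: (scalerI b1n0); move: E2.
  by rewrite b2E (scalerI b1n0 E1) => /addrI.
- subst c1; apply: Or32.
  have b2E : c2 = - b2.
    by apply: (mulfI b1n0); lra.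
  have J1 : dual1 J' = - dual1 J.
    by apply: (scalerI b1n0); rewrite scalerN E1 scaleNr opprK.
  rewrite b2E; split; first exact: cplxP.
  apply: dualP => //; apply: (scalerI b1n0); move: E2.
  rewrite b2E J1 scalerN !scaleNr opprK => /addrI E2.
  by rewrite /= scalerN E2 opprK.
Qed.

End Sphere.

(** * Slice functions and their stem functions *)

Section DhcConj.
Variable R : realType.
Implicit Types F : cplx (DH R).

Lemma dh_conjN (x : DH R) : dh_conj (- x) = - dh_conj x.
Proof.
have c0 : dh_conj (0 : DH R) = 0.
  by apply: (addIr (dh_conj 0)); rewrite -dh_conjD !add0r.
by apply/eqP; rewrite -addr_eq0 -dh_conjD addNr c0.
Qed.

Lemma dhc_conjD F F' : dhc_conj (F + F') = dhc_conj F + dhc_conj F'.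
Proof. by apply: cplxP; exact: dh_conjD. Qed.

Lemma dhc_conjM F F' : dhc_conj (F * F') = dhc_conj F' * dhc_conj F.
Proof.
rewrite -[RHS]/(cplx_mul _ _) -[F * F']/(cplx_mul F F').
apply: cplxP; rewrite /= dh_conjD ?dh_conjN !dh_conjM //.
by rewrite addrC.
Qed.

Lemma dhc_conjK : involutive (@dhc_conj R).
Proof. by move=> F; apply: cplxP; exact: dh_conjK. Qed.

Lemma dhc_conj_bar F : dhc_conj (cplx_bar F) = cplx_bar (dhc_conj F).
Proof. by apply: cplxP => //; exact: dh_conjN. Qed.

Lemma quat_conjZ (k : R) (x : quat R) : quat_conj (k *: x) = k *: quat_conj x.
Proof.
by rewrite -mulr_algl quat_conjM quat_conj_alg mulr_algr.
Qed.

Lemma dh_conjZ (k : R) (x : DH R) : dh_conj (k *: x) = k *: dh_conj x.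
Proof. by rewrite -mulr_algl dh_conjM dh_conj_alg mulr_algr. Qed.

Lemma dhc_conjZ (k : R) F : dhc_conj (k *: F) = k *: dhc_conj F.
Proof. by apply: cplxP; exact: dh_conjZ. Qed.

Definition quatc_conj (x : cplx (quat R)) : cplx (quat R) :=
  mkcplx (quat_conj (cplx0 x)) (quat_conj (cplx1 x)).

Lemma linear_quatc_conj : linear quatc_conj.
Proof.
by move=> k x y; apply: cplxP; rewrite /= quat_conjD quat_conjZ.
Qed.

Lemma quatc_conj_bar x : quatc_conj (cplx_bar x) = cplx_bar (quatc_conj x).
Proof. by apply: cplxP => //=; rewrite -scaleN1r quat_conjZ scaleN1r. Qed.

End DhcConj.

(** Applied to the values F_0 + J F_1 and F_0 - J F_1 of two stem functions. *)
Lemma sub_eq_opp (V : zmodType) (a b c d : V) :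
  a + b = c + d -> a - b = c - d -> b - d = - (b - d).
Proof.
move=> /(canRL (addrK _)) ->; rewrite -!addrA => /addrI; rewrite addrA.
by move=> /(canRL (subrK _)) E; rewrite opprB E addrC.
Qed.

Section SliceTheory.
Variables (R : realType) (D : set (cplx R)).
Implicit Types F : cplx R -> cplx (DH R).

Lemma stemD (A : nzRingType) (F F' : cplx R -> cplx A) :
  stem D F -> stem D F' -> stem D (F \+ F').
Proof. by move=> sF sF' z Dz; rewrite /= sF // sF' // cplx_barD. Qed.

Lemma stemM (A : nzRingType) (F F' : cplx R -> cplx A) :
  stem D F -> stem D F' -> stem D (F \* F').
Proof. by move=> sF sF' z Dz; rewrite /= sF // sF' // cplx_barM. Qed.

Lemma stem_cst (A : nzRingType) (q : A) : stem D (fun=> mkcplx q 0).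
Proof. by move=> z Dz; apply: cplxP; rewrite //= oppr0. Qed.

Definition dual_of_real (z : cplx R) : cplx (dual R) :=
  mkcplx (mkdual (cplx0 z) 0) (mkdual (cplx1 z) 0).

Lemma real_slice_point z (J : DH R) :
  (cplx0 z)%:A + J * (cplx1 z)%:A = slice_point (dual_of_real z) J.
Proof.
have drE (a : R) : dr_to_dh (mkdual a 0) = a%:A.
  by apply: dualP; rewrite /= ?scale0r ?scaler0.
by rewrite /slice_point /= !drE.
Qed.

Lemma dual_of_real_inj : injective dual_of_real.
Proof. by move=> [a b] [c d] [-> ->]. Qed.

(** At a degenerate representation z is real, so the stem symmetry gives F_1 = 0
    and the value is F_0. *)
Lemma eval_stem_real (z z' : cplx R) J J' F : stem D F -> D z -> D z' ->
  sphereDH J -> sphereDH J' ->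
  slice_point (dual_of_real z) J = slice_point (dual_of_real z') J' ->
  eval_at J (F z) = eval_at J' (F z').
Proof.
move=> sF Dz Dz' SJ SJ' /(slice_point_inj SJ SJ').
case=> [[/dual_of_real_inj -> ->] //|[zz' ->]|].
  have -> : z' = cplx_bar z.
    apply: dual_of_real_inj; rewrite zz'.
    by apply: cplxP => //; apply: dualP; rewrite //= oppr0.
  by rewrite sF // eval_at_bar.
case: z z' Dz Dz' => [a b] [a' b'] Dz Dz' [/= [aa] b0 b0' _].
rewrite aa b0 b0' in Dz Dz' *.
have F0 : cplx1 (F (a, 0)) = 0.
  apply: (@eq_opp0 R); have := sF _ Dz.
  by rewrite /cplx_bar /= oppr0 => /(congr1 (@cplx1 _)).
by rewrite /eval_at F0 !mulr0.
Qed.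

Lemma Omega_reprP (x : Omega D) :
  [/\ D (Omega_repr x).1, sphereDH (Omega_repr x).2 &
     val x = slice_point (dual_of_real (Omega_repr x).1) (Omega_repr x).2].
Proof.
rewrite /Omega_repr; case: (cid (OmegaP x)) => [[z J]] /= [Dz SJ ->].
by rewrite -real_slice_point.
Qed.

Lemma slice_funE F (x : Omega D) :
  slice_fun F x = eval_at (Omega_repr x).2 (F (Omega_repr x).1).
Proof. by rewrite /slice_fun; case: (Omega_repr x). Qed.

Lemma slice_fun_at F (x : Omega D) z J : stem D F -> D z -> sphereDH J ->
  val x = slice_point (dual_of_real z) J -> slice_fun F x = eval_at J (F z).
Proof.
move=> sF Dz SJ xE; have [Dz' SJ' xE'] := Omega_reprP x.
by rewrite slice_funE; apply: eval_stem_real => //; rewrite -xE'.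
Qed.

Lemma eq_slice_fun F F' : (forall z, D z -> F z = F' z) ->
  slice_fun F = slice_fun F' :> (Omega D -> DH R).
Proof.
move=> FF'; apply/funext => x; rewrite !slice_funE.
by have [Dz _ _] := Omega_reprP x; rewrite FF'.
Qed.

Lemma slice_point_Omega z (J : DH R) : D z -> sphereDH J ->
  Omega D (slice_point (dual_of_real z) J).
Proof.
by move=> Dz SJ; exists (z, J); split => //=; rewrite real_slice_point.
Qed.

(** Evaluation at J and at -J separates F_0 from J F_1, and J is invertible. *)
Lemma slice_fun_inj F F' : stem D F -> stem D F' ->
  slice_fun F = slice_fun F' :> (Omega D -> DH R) ->
  forall z, D z -> F z = F' z.
Proof.
move=> sF sF' FF' z Dz.
have at_sphere J : sphereDH J -> eval_at J (F z) = eval_at J (F' z).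
  move=> SJ; pose x : Omega D := SigSub (mem_set (slice_point_Omega Dz SJ)).
  by rewrite -(@slice_fun_at F x) // -(@slice_fun_at F' x) // FF'.
have [J SJ] := sphere_inhabited R.
have Ep := at_sphere _ SJ; have En := at_sphere _ (sphereN SJ).
have E1 : cplx1 (F z) = cplx1 (F' z).
  apply: (sphere_lreg SJ); apply/eqP; rewrite -subr_eq0; apply/eqP.
  apply: (@eq_opp0 R); move: Ep En; rewrite /eval_at !mulNr => Ep En.
  exact: sub_eq_opp Ep En.
apply: cplxP => //; move: Ep; rewrite /eval_at E1; exact: addIr.
Qed.

Lemma stem_ofP F : stem D F ->
  stem D (stem_of (slice_fun F : Omega D -> DH R)) /\
  forall z, D z -> stem_of (slice_fun F : Omega D -> DH R) z = F z.
Proof.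
move=> sF.
have [sG GE] :
    [set G | stem D G /\ slice_fun G = (slice_fun F : Omega D -> DH R)]
      (stem_of (slice_fun F : Omega D -> DH R)).
  by apply: xgetPex; exists F.
by split => //; apply: slice_fun_inj.
Qed.

Lemma slice_mulE F F' : stem D F -> stem D F' ->
  slice_mul (slice_fun F) (slice_fun F') =
    slice_fun (F \* F') :> (Omega D -> DH R).
Proof.
move=> sF sF'; apply: eq_slice_fun => z Dz.
by rewrite (stem_ofP sF).2 // (stem_ofP sF').2.
Qed.

Lemma slice_conjE F : stem D F ->
  slice_conj (slice_fun F) = slice_fun (@dhc_conj R \o F) :> (Omega D -> DH R).
Proof. by move=> sF; apply: eq_slice_fun => z Dz; rewrite (stem_ofP sF).2. Qed.

Lemma slice_funD F F' :
  slice_fun F + slice_fun F' = slice_fun (F \+ F') :> (Omega D -> DH R).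
Proof. by apply/funext => x; rewrite [RHS]slice_funE eval_atD -!slice_funE. Qed.

Lemma slice_fun_mulr F q :
  fun_rscale (slice_fun F) q =
    slice_fun (fun z => F z * mkcplx q 0) :> (Omega D -> DH R).
Proof. by apply/funext => x; rewrite /fun_rscale !slice_funE eval_at_mulr. Qed.

Lemma slice_fun_conj F : stem D F ->
  slice_fun F \o conj_Omega =
    slice_fun (@cplx_bar (DH R) \o F) :> (Omega D -> DH R).
Proof.
move=> sF; apply/funext => x /=.
have [Dz SJ xE] := Omega_reprP x.
rewrite [RHS]slice_funE /=.
rewrite -[X in eval_at X]opprK eval_at_bar.
apply: slice_fun_at => //; first exact: sphereN.
by rewrite -conj_slice_point // -xE.
Qed.

End SliceTheory.

(** * Natural extension *)

Section DualPack.
Variable R : realType.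
Local Notation CH := (cplx (quat R)).
Implicit Types g h : CH.

(** The identification of G + eps H, with G and H in the complexified
    quaternions, with an element of the complexified dual quaternions. *)
Definition dual_pack g h : cplx (DH R) :=
  mkcplx (mkdual (cplx0 g) (cplx0 h)) (mkdual (cplx1 g) (cplx1 h)).

Lemma dual_pack_inj g h g' h' : dual_pack g h = dual_pack g' h' ->
  g = g' /\ h = h'.
Proof. by case: g h g' h' => [? ?] [? ?] [? ?] [? ?] [-> -> -> ->]. Qed.

Lemma dual_packD g h g' h' :
  dual_pack (g + g') (h + h') = dual_pack g h + dual_pack g' h'.
Proof. by []. Qed.

Lemma dual_packM g h g' h' :
  dual_pack (g * g') (g * h' + h * g') = dual_pack g h * dual_pack g' h'.
Proof.
rewrite -[g * g']/(cplx_mul _ _) -[g * h']/(cplx_mul _ _).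
rewrite -[h * g']/(cplx_mul _ _) -[RHS]/(cplx_mul _ _).
apply: cplxP; apply: dualP => //=; rewrite ?opprD addrACA //.
Qed.

Lemma dual_pack_cst (q : DH R) :
  dual_pack (mkcplx (dual1 q) 0) (mkcplx (dual2 q) 0) = mkcplx q 0.
Proof. by case: q. Qed.

Lemma dual_pack_bar g h :
  dual_pack (cplx_bar g) (cplx_bar h) = cplx_bar (dual_pack g h).
Proof. by []. Qed.

End DualPack.

Section Extension.
Variables (R : realType) (D : set (cplx R)).
Hypothesis hD : open D.
Hypothesis hDbar : forall z, D z -> D (cplx_bar z).
Local Notation CH := (cplx (quat R)).
Implicit Types G H : cplx R -> CH.

(** The extended stem function, first order Taylor expansion of F in the dual
    direction. *)
Definition check_stem G H (w : cplx (dual R)) : cplx (DH R) :=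
  let z := std_part w in
  dual_pack (G z) (H z + dual2 (cplx0 w) *: d_alpha G z
                  + dual2 (cplx1 w) *: d_beta G z).

Lemma eq_check_stem G H G' H' w : (forall z, D z -> G z = G' z) ->
  (forall z, D z -> H z = H' z) -> Dcheck D w ->
  check_stem G H w = check_stem G' H' w.
Proof.
move=> GG' HH' Dw; rewrite /check_stem (GG' _ Dw) (HH' _ Dw).
by rewrite (eq_d_alpha hD GG' Dw) (eq_d_beta hD GG' Dw).
Qed.

Lemma check_stem_real G H z :
  check_stem G H (dual_of_real z) = dual_pack (G z) (H z).
Proof.
case: z => a b; rewrite /check_stem /dual_of_real /std_part /=.
move: (d_alpha G _) (d_beta G _) => A B.
by rewrite !scale0r !addr0.
Qed.

Lemma partials_linear (W : normedModType R) (L : CH -> W) G z :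
  linear L -> continuous L -> C1_on D G -> D z ->
  d_alpha (L \o G) z = L (d_alpha G z) /\ d_beta (L \o G) z = L (d_beta G z).
Proof.
move=> linL cL CG Dz; have [[? _] [? _]] := C1_on_derive CG Dz.
by split; rewrite /d_alpha /d_beta;
  apply: (@derive_val _ _ _ _ _ _ _ (is_derive_linear linL cL _)).
Qed.

Lemma check_stemE G H w : C1_on D G -> Dcheck D w ->
  mkcplx (checkF (fun z => cplx0 (G z)) (fun z => cplx0 (H z)) w)
         (checkF (fun z => cplx1 (G z)) (fun z => cplx1 (H z)) w) =
  check_stem G H w.
Proof.
move=> CG Dw.
have lin0 : linear (@cplx0 (quat R)) by [].
have lin1 : linear (@cplx1 (quat R)) by [].
have [a0 b0] := partials_linear lin0 (cq_linear_continuous lin0) CG Dw.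
have [a1 b1] := partials_linear lin1 (cq_linear_continuous lin1) CG Dw.
rewrite /= in a0 b0 a1 b1.
by rewrite /checkF -/(@cplx0 _ \o G) -/(@cplx1 _ \o G) a0 b0 a1 b1.
Qed.

Lemma check_stemD G H G' H' w : C1_on D G -> C1_on D G' -> Dcheck D w ->
  check_stem (G \+ G') (H \+ H') w = check_stem G H w + check_stem G' H' w.
Proof.
move=> CG CG' Dw; rewrite /check_stem -dual_packD; congr dual_pack.
have [? ?] := C1_on_derive CG Dw; have [? ?] := C1_on_derive CG' Dw.
have -> : d_alpha (G \+ G') (std_part w) =
    d_alpha G (std_part w) + d_alpha G' (std_part w) by apply: deriveD.
have -> : d_beta (G \+ G') (std_part w) =
    d_beta G (std_part w) + d_beta G' (std_part w) by apply: deriveD.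
by rewrite /= !scalerDr [RHS]addrACA [X in _ = X + _]addrACA.
Qed.

Lemma check_stem_mulr G H (q : DH R) w : C1_on D G -> Dcheck D w ->
  check_stem (G \* cst (mkcplx (dual1 q) 0))
    (G \* cst (mkcplx (dual2 q) 0) \+ H \* cst (mkcplx (dual1 q) 0)) w =
  check_stem G H w * mkcplx q 0.
Proof.
move=> CG Dw; rewrite -dual_pack_cst /check_stem -dual_packM; congr dual_pack.
set c := mkcplx (dual1 q) 0.
have linM : linear (fun x : CH => x * c).
  by move=> k x y; rewrite mulrDl cplx_scaleAl.
have [da db] := partials_linear linM (cq_linear_continuous linM) CG Dw.
rewrite -[G \* cst c]/((fun x : CH => x * c) \o G) da db /=.
by rewrite !mulrDl !cplx_scaleAl !addrA.
Qed.

Lemma check_stem_bar G H w : C1_on D G -> Dcheck D w ->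
  check_stem (@cplx_bar _ \o G) (@cplx_bar _ \o H) w =
  cplx_bar (check_stem G H w).
Proof.
move=> CG Dw; rewrite /check_stem -dual_pack_bar; congr dual_pack.
have linb := @linear_cplx_bar R (quat R).
have [-> ->] := partials_linear linb (cq_linear_continuous linb) CG Dw.
by rewrite !cplx_barD; congr (_ + _ + _); apply: cplxP; rewrite //= scalerN.
Qed.

(** Differentiates G (bar z) = bar (G z): the reflection fixes the real
    direction. *)
Lemma d_alpha_stem G z : stem D G -> C1_on D G -> D z ->
  d_alpha G (cplx_bar z) = cplx_bar (d_alpha G z).
Proof.
move=> sG CG Dz.
have linb := @linear_cplx_bar R (quat R).
have [dE _] := partials_linear linb (cq_linear_continuous linb) CG Dz.
apply: etrans dE.
rewrite -(eq_d_alpha hD sG Dz); apply/esym; apply: derive_comp_affine => h.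
by apply: cplxP; rewrite //= scaler0 !add0r.
Qed.

(** Differentiates G (bar z) = bar (G z): the reflection reverses the imaginary
    direction, whence the sign. *)
Lemma d_beta_stem G z : stem D G -> C1_on D G -> D z ->
  d_beta G (cplx_bar z) = - cplx_bar (d_beta G z).
Proof.
move=> sG CG Dz.
have linb := @linear_cplx_bar R (quat R).
have [_ dE] := partials_linear linb (cq_linear_continuous linb) CG Dz.
apply: etrans (congr1 -%R dE).
rewrite -(eq_d_beta hD sG Dz) /d_beta.
rewrite (@derive_comp_affine _ _ _ _ (@cplx_bar R) _ _ _ (- mkcplx 0 1)).
  rewrite derive_oppv ?opprK //.
  by have [_ []] := C1_on_derive CG (hDbar Dz).
by move=> h; apply: cplxP; rewrite /= ?oppr0 // opprD scalerN.
Qed.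

(** The sign of the beta-derivative is absorbed by that of the dual part of b,
    so the extended stem function is again symmetric. *)
Lemma check_stem_stem G H w : stem D G -> stem D H -> C1_on D G ->
  Dcheck D w -> check_stem G H (cplx_bar w) = cplx_bar (check_stem G H w).
Proof.
move=> sG sH CG Dw; rewrite /check_stem -dual_pack_bar.
have -> : std_part (cplx_bar w) = cplx_bar (std_part w) by [].
rewrite sG // sH // d_alpha_stem // d_beta_stem //; congr dual_pack.
rewrite !cplx_barD /= scaleNr scalerN opprK.
by congr (_ + _ + _); apply: cplxP; rewrite //= scalerN.
Qed.

(** Independence of the representation.  Conjugate representations agree by
    symmetry; at a degenerate point z is real, and by the symmetry of G, H and of
    the partial derivatives the only term involving J is eps J b_2 times the
    derivative of G_1 along beta. *)
Lemma eval_check_stem G H w w' J J' : stem D G -> stem D H -> C1_on D G ->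
  Dcheck D w -> Dcheck D w' -> sphereDH J -> sphereDH J' ->
  slice_point w J = slice_point w' J' ->
  eval_at J (check_stem G H w) = eval_at J' (check_stem G H w').
Proof.
move=> sG sH CG Dw Dw' SJ SJ' /(slice_point_inj SJ SJ').
case=> [[-> ->] //|[-> ->]|].
  by rewrite check_stem_stem // eval_at_bar.
case: w w' Dw Dw' => [[a1 a2] [b1 b2]] [[c1 c2] [d1 d2]] Dw Dw'.
move=> [/= [cE1 cE2] b0 d0 JE].
subst c1 c2 b1 d1; rewrite /Dcheck /std_part /= in Dw.
(* The standard part of the representation is the real point a1, fixed by
   conjugation. *)
have zb : cplx_bar (mkcplx a1 0) = mkcplx a1 0 :> cplx R.
  by apply: cplxP; rewrite //= oppr0.
have real1 (x : CH) : x = cplx_bar x -> cplx1 x = 0.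
  by move/(congr1 (@cplx1 _)) => /= /eq_opp0.
have G1 : cplx1 (G (mkcplx a1 0)) = 0 by apply: real1; rewrite -sG ?zb.
have H1 : cplx1 (H (mkcplx a1 0)) = 0 by apply: real1; rewrite -sH ?zb.
have A1 : cplx1 (d_alpha G (mkcplx a1 0)) = 0.
  by apply: real1; rewrite -d_alpha_stem ?zb.
have B0 : cplx0 (d_beta G (mkcplx a1 0)) = 0.
  have := @d_beta_stem G _ sG CG Dw; rewrite zb => /(congr1 (@cplx0 _)) /=.
  exact: eq_opp0.
rewrite /check_stem -[std_part _]/(mkcplx a1 0).
rewrite -[std_part (_, (0, d2))]/(mkcplx a1 0).
move: G1 H1 A1 B0; move: (G _) (H _) (d_alpha G _) (d_beta G _).
move=> [g0 g1] [h0 h1] [A0 A1] [B0 B1] /= -> -> -> ->.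
rewrite /eval_at; apply: dualP => /=; rewrite !mulr0 //.
rewrite !addr0 !scaler0 !addr0 !add0r.
by rewrite -!scalerAr !scalerAl JE.
Qed.

Lemma Omegacheck_reprP (x : Omegacheck D) :
  [/\ Dcheck D (Omegacheck_repr x).1, sphereDH (Omegacheck_repr x).2 &
     val x = slice_point (Omegacheck_repr x).1 (Omegacheck_repr x).2].
Proof. by rewrite /Omegacheck_repr; case: (cid (OmegacheckP x)). Qed.

Lemma stem_dual_stem G H : stem D G -> stem D H -> stem D (dual_stem G H).
Proof.
move=> sG sH z Dz.
rewrite -[LHS]/(dual_pack _ _) -[dual_stem G H z]/(dual_pack _ _).
by rewrite sG // sH.
Qed.

Lemma S10_data_unique f G H G' H' : @S10_data R D f (G, H) ->
  S10_data f (G', H') ->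
  (forall z, D z -> G z = G' z) /\ (forall z, D z -> H z = H' z).
Proof.
case=> /= sG sH _ _ -> [/= sG' sH' _ _] E.
have FE z : D z -> G z = G' z /\ H z = H' z.
  move=> Dz; apply: dual_pack_inj.
  exact: (slice_fun_inj (stem_dual_stem sG sH) (stem_dual_stem sG' sH') E).
by split=> z /FE [].
Qed.

(** Gives access to the extension from any data (G, H) and any representation of
    the point, in place of those selected by choice. *)
Lemma natural_ext_at f G H (x : Omegacheck D) w J :
  S10_data f (G, H) -> Dcheck D w -> sphereDH J -> val x = slice_point w J ->
  natural_ext f x = eval_at J (check_stem G H w).
Proof.
move=> fGH Dw SJ xE; rewrite /natural_ext.
have : S10_data f (xget (fun=> 0, fun=> 0) (S10_data f)).
  by apply: xgetPex; exists (G, H).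
case: (xget _ _) => G' H' fGH'.
have [Dw' SJ' xE'] := Omegacheck_reprP x.
case: (Omegacheck_repr x) Dw' SJ' xE' => w' J' /= Dw' SJ' xE'.
have [sG' sH' CG' _ _] := fGH'.
transitivity (eval_at J' (check_stem G' H' w')).
  by rewrite -(check_stemE H' CG' Dw').
have [GE HE] := S10_data_unique fGH fGH'.
rewrite (eq_check_stem GE HE Dw).
apply: (eval_check_stem sG' sH' CG' Dw' Dw SJ' SJ).
by rewrite -xE'.
Qed.

Lemma natural_extE f G H (x : Omegacheck D) : S10_data f (G, H) ->
  natural_ext f x =
  eval_at (Omegacheck_repr x).2 (check_stem G H (Omegacheck_repr x).1).
Proof.
by move=> fGH; have [Dw SJ xE] := Omegacheck_reprP x; apply: natural_ext_at.
Qed.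

Lemma S10_dataD f f' G H G' H' : @S10_data R D f (G, H) ->
  S10_data f' (G', H') -> S10_data (f + f') (G \+ G', H \+ H').
Proof.
move=> [/= sG sH CG cH ->] [/= sG' sH' CG' cH' ->]; split => /=.
- exact: stemD.
- exact: stemD.
- exact: C1_onD.
- exact: continuous_onD.
- exact: slice_funD.
Qed.

Lemma S10_dataM f f' G H G' H' : @S10_data R D f (G, H) ->
  S10_data f' (G', H') ->
  S10_data (slice_mul f f') (G \* G', G \* H' \+ H \* G').
Proof.
move=> [/= sG sH CG cH ->] [/= sG' sH' CG' cH' ->]; split => /=.
- exact: stemM.
- by apply: stemD; exact: stemM.
- exact: C1_on_mul.
- have cG := C1_on_continuous hD CG; have cG' := C1_on_continuous hD CG'.
  apply: continuous_onD; [exact: continuous_on_mul cG cH'|].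
  exact: continuous_on_mul cH cG'.
- rewrite slice_mulE; try exact: stem_dual_stem.
  by apply: eq_slice_fun => z _; rewrite /= -dual_packM.
Qed.

Lemma S10_data_cst (q : DH R) :
  S10_data (slice_fun (fun=> mkcplx q 0) : Omega D -> DH R)
    (fun=> mkcplx (dual1 q) 0, fun=> mkcplx (dual2 q) 0).
Proof.
split => /=.
- exact: stem_cst.
- exact: stem_cst.
- exact: C1_on_cst.
- by move=> z Dz; exact: cst_continuous.
- by apply: eq_slice_fun => z _; rewrite -dual_pack_cst.
Qed.

(** A right multiple is a slice product with a constant slice function. *)
Lemma S10_data_mulr f G H (q : DH R) : @S10_data R D f (G, H) ->
  S10_data (fun_rscale f q) (G \* cst (mkcplx (dual1 q) 0),
    G \* cst (mkcplx (dual2 q) 0) \+ H \* cst (mkcplx (dual1 q) 0)).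
Proof.
move=> fGH.
have -> : fun_rscale f q = slice_mul f (slice_fun (fun=> mkcplx q 0)).
  have [sG sH _ _ ->] := fGH.
  rewrite slice_fun_mulr slice_mulE //; first exact: stem_dual_stem.
  exact: stem_cst.
exact: S10_dataM (S10_data_cst q).
Qed.

Lemma S10_data_conj f G H : @S10_data R D f (G, H) ->
  S10_data (slice_conj f) (@quatc_conj R \o G, @quatc_conj R \o H).
Proof.
have linc := @linear_quatc_conj R; have contc := cq_linear_continuous linc.
move=> [/= sG sH CG cH ->]; split => /=.
- by move=> z Dz; rewrite /= sG // quatc_conj_bar.
- by move=> z Dz; rewrite /= sH // quatc_conj_bar.
- exact: C1_on_linear.
- exact: continuous_on_linear.
- by rewrite slice_conjE //; exact: stem_dual_stem.
Qed.

Lemma S10_data_conj_Omega f G H : @S10_data R D f (G, H) ->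
  S10_data (f \o conj_Omega) (@cplx_bar _ \o G, @cplx_bar _ \o H).
Proof.
have linb := @linear_cplx_bar R (quat R).
have contb := cq_linear_continuous linb.
move=> [/= sG sH CG cH ->]; split => /=.
- by move=> z Dz; rewrite /= sG.
- by move=> z Dz; rewrite /= sH.
- exact: C1_on_linear.
- exact: continuous_on_linear.
- by rewrite slice_fun_conj //; exact: stem_dual_stem.
Qed.

Lemma natural_extD (f f' : Omega D -> DH R) : S10 D f -> S10 D f' ->
  natural_ext (f + f') = natural_ext f + natural_ext f'.
Proof.
move=> [[G H] fGH] [[G' H'] fGH']; apply/funext => x.
have [Dw _ _] := Omegacheck_reprP x.
rewrite (natural_extE x (S10_dataD fGH fGH')) check_stemD //.
- rewrite eval_atD; apply: esym.
  exact: (f_equal2 +%R (natural_extE x fGH) (natural_extE x fGH')).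
- by case: fGH.
- by case: fGH'.
Qed.

Lemma natural_ext_mulr (f : Omega D -> DH R) q : S10 D f ->
  natural_ext (fun_rscale f q) = fun_rscale (natural_ext f) q.
Proof.
move=> [[G H] fGH]; apply/funext => x.
have [Dw _ _] := Omegacheck_reprP x.
rewrite (natural_extE x (S10_data_mulr q fGH)) check_stem_mulr //.
  rewrite eval_at_mulr; apply: esym.
  exact: (congr1 (fun y => y * q) (natural_extE x fGH)).
by case: fGH.
Qed.

Lemma natural_ext_restr (f : Omega D -> DH R) : S10 D f ->
  restr_Omega (natural_ext f) = f.
Proof.
move=> [[G H] fGH]; apply/funext => x; rewrite /restr_Omega /=.
have [Dz SJ xE] := Omega_reprP x.
have Dw : Dcheck D (dual_of_real (Omega_repr x).1).
  by move: Dz; rewrite /Dcheck /=; case: (Omega_repr x).1.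
rewrite (natural_ext_at (w := dual_of_real (Omega_repr x).1) fGH Dw SJ) //.
have [_ _ _ _ ->] := fGH; by rewrite slice_funE check_stem_real.
Qed.

Lemma natural_ext_conj_Omega (f : Omega D -> DH R) : S10 D f ->
  natural_ext (f \o conj_Omega) = natural_ext f \o conj_Omegacheck.
Proof.
move=> [[G H] fGH]; apply/funext => x.
have [Dw SJ xE] := Omegacheck_reprP x.
rewrite (natural_extE x (S10_data_conj_Omega fGH)) check_stem_bar //;
  last by case: fGH.
rewrite -[X in eval_at X]opprK eval_at_bar; apply/esym.
apply: natural_ext_at => //; first exact: sphereN.
by rewrite -conj_slice_point // -xE.
Qed.

End Extension.

(** * Modules and star-algebras *)

(** On functions with values in A the module identities hold pointwise, so only
    closure has to be checked; opposites are multiples by -1. *)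
Lemma right_module_fun (T : Type) (A : nzRingType) (M : set (T -> A)) :
  M 0 -> (forall u v, M u -> M v -> M (u + v)) ->
  (forall u a, M u -> M (fun_rscale u a)) -> right_module (@fun_rscale T A) M.
Proof.
move=> M0 MD Ma; split=> //.
- move=> u Mu; rewrite (_ : - u = fun_rscale u (-1)); first exact: Ma.
  by apply/funext => x; rewrite /fun_rscale mulrN1.
- by move=> u v a _ _; apply/funext => x; exact: mulrDl.
- by move=> u a b _; apply/funext => x; exact: mulrDr.
- by move=> u a b _; apply/funext => x; rewrite /fun_rscale mulrA.
- by move=> u _; apply/funext => x; exact: mulr1.
Qed.

Lemma right_module_image (A : nzRingType) (V W : zmodType) actV actW
    (M : set V) (phi : V -> W) :
  @right_module A V actV M ->
  (forall u v, M u -> M v -> phi (u + v) = phi u + phi v) ->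
  (forall u a, M u -> phi (actV u a) = actW (phi u) a) ->
  right_module actW (phi @` M).
Proof.
move=> [M0 MD MN Ma aDl aDr aA a1] phiD phia.
have phi0 : phi 0 = 0 by apply: (addIr (phi 0)); rewrite -phiD // !add0r.
split.
- by exists 0.
- by move=> _ _ [u Mu <-] [v Mv <-]; exists (u + v); [exact: MD|exact: phiD].
- move=> _ [u Mu <-]; exists (- u); first exact: MN.
  by apply/eqP; rewrite -addr_eq0 -phiD ?addNr ?phi0 //; exact: MN.
- by move=> _ a [u Mu <-]; exists (actV u a); [exact: Ma|exact: phia].
- move=> _ _ a [u Mu <-] [v Mv <-].
  rewrite -phiD // -!phia // ?aDl // ?phiD //;
    by [exact: Ma|exact: MD].
- move=> _ a b [u Mu <-]; rewrite -!phia // aDr // phiD //; exact: Ma.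
- by move=> _ a b [u Mu <-]; rewrite -!phia // ?aA //; exact: Ma.
- by move=> _ [u Mu <-]; rewrite -phia // a1.
Qed.

(** The transported operations pull back along the left inverse psi. *)
Lemma star_algebra_transport (K : comNzRingType) (V W : lmodType K)
    (M : set V) mul conj (phi : V -> W) (psi : W -> V) :
  star_algebra M mul conj ->
  (forall u v, M u -> M v -> phi (u + v) = phi u + phi v) ->
  (forall (k : K) u, M u -> phi (k *: u) = k *: phi u) ->
  (forall u, M u -> psi (phi u) = u) ->
  star_algebra_iso M mul conj (phi @` M)
    (fun g h => phi (mul (psi g) (psi h))) (fun g => phi (conj (psi g))) phi.
Proof.
move=> sM phiD phiZ phiK.
have [M0 MD MZ MM mA mDl mDr mZl mZr [e Me eP] Mc cD cZ cM cK] := sM.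
have phi0 : phi 0 = 0 by apply: (addIr (phi 0)); rewrite -phiD // !add0r.
split=> //.
- split.
  + by exists 0.
  + by move=> _ _ [u Mu <-] [v Mv <-]; exists (u + v); [exact: MD|exact: phiD].
  + by move=> k _ [u Mu <-]; exists (k *: u); [exact: MZ|exact: phiZ].
  + move=> _ _ [u Mu <-] [v Mv <-]; exists (mul u v); first exact: MM.
    by rewrite !phiK.
  + move=> _ _ _ [u Mu <-] [v Mv <-] [w Mw <-]; rewrite !phiK //; try exact: MM.
    by rewrite mA.
  + move=> _ _ _ [u Mu <-] [v Mv <-] [w Mw <-].
    rewrite -phiD // !phiK //; last exact: MD.
    by rewrite mDl // phiD //; exact: MM.
  + move=> _ _ _ [u Mu <-] [v Mv <-] [w Mw <-].
    rewrite -phiD // !phiK //; last exact: MD.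
    by rewrite mDr // phiD //; exact: MM.
  + move=> k _ _ [u Mu <-] [v Mv <-].
    rewrite -phiZ // !phiK //; last exact: MZ.
    by rewrite mZl // phiZ //; exact: MM.
  + move=> k _ _ [u Mu <-] [v Mv <-].
    rewrite -phiZ // !phiK //; last exact: MZ.
    by rewrite mZr // phiZ //; exact: MM.
  + exists (phi e); first by exists e.
    by move=> _ [u Mu <-]; rewrite !phiK //; have [-> ->] := eP u Mu.
  + by move=> _ [u Mu <-]; exists (conj u); [exact: Mc|rewrite phiK].
  + move=> _ _ [u Mu <-] [v Mv <-]; rewrite -phiD // !phiK //; last exact: MD.
    by rewrite cD // phiD //; exact: Mc.
  + move=> k _ [u Mu <-]; rewrite -phiZ // !phiK //; last exact: MZ.
    by rewrite cZ // phiZ //; exact: Mc.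
  + move=> _ _ [u Mu <-] [v Mv <-].
    by rewrite !phiK //; [rewrite cM|exact: Mc|exact: Mc|exact: MM].
  + by move=> _ [u Mu <-]; rewrite !phiK //; [rewrite cK|exact: Mc].
- split => //.
  by move=> u v /set_mem Mu /set_mem Mv /(congr1 psi); rewrite !phiK.
- by move=> u v Mu Mv; rewrite !phiK.
- by move=> u Mu; rewrite phiK.
Qed.

Lemma star_algebra_iso_unique (K : comNzRingType) (V W : lmodType K)
    (M : set V) mul conj (phi : V -> W) mul1 conj1 mul2 conj2 :
  star_algebra_iso M mul conj (phi @` M) mul1 conj1 phi ->
  star_algebra_iso M mul conj (phi @` M) mul2 conj2 phi ->
  (forall g h, (phi @` M) g -> (phi @` M) h -> mul2 g h = mul1 g h) /\
  (forall g, (phi @` M) g -> conj2 g = conj1 g).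
Proof.
move=> [_ _ _ _ _ M1 c1] [_ _ _ _ _ M2 c2]; split.
  by move=> _ _ [u Mu <-] [v Mv <-]; rewrite -M2 // M1.
by move=> _ [u Mu <-]; rewrite -c2 // c1.
Qed.

Section SliceAlgebra.
Variables (R : realType) (D : set (cplx R)).
Hypothesis hD : open D.

Lemma S10_stem (f : Omega D -> DH R) : S10 D f ->
  exists2 F, stem D F & f = slice_fun F.
Proof.
move=> [[G H] [/= sG sH _ _ ->]]; exists (dual_stem G H) => //.
exact: stem_dual_stem.
Qed.

Lemma S10_cst q : S10 D (slice_fun (fun=> mkcplx q 0)).
Proof. by eexists; exact: S10_data_cst. Qed.

Lemma S10_0 : S10 D 0.
Proof.
have := S10_cst 0; congr S10; apply/funext => x.
by rewrite slice_funE /eval_at /= mulr0 addr0.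
Qed.

Lemma S10_add f g : S10 D f -> S10 D g -> S10 D (f + g).
Proof. by move=> [[? ?] fG] [[? ?] gG]; eexists; exact: S10_dataD fG gG. Qed.

Lemma S10_mulr f q : S10 D f -> S10 D (fun_rscale f q).
Proof. by move=> [[? ?] fG]; eexists; exact: S10_data_mulr fG. Qed.

Lemma scale_fun_rscale (T : Type) (k : R) (f : T -> DH R) :
  k *: f = fun_rscale f k%:A.
Proof. by apply/funext => x; rewrite /fun_rscale mulr_algr. Qed.

Lemma right_module_S10 : right_module (@fun_rscale _ (DH R)) (S10 D).
Proof. exact: right_module_fun S10_0 S10_add S10_mulr. Qed.

Lemma slice_funZ k (F : cplx R -> cplx (DH R)) :
  k *: (slice_fun F : Omega D -> DH R) = slice_fun (fun z => k *: F z).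
Proof.
apply/funext => x; rewrite [RHS]slice_funE /= /eval_at /=.
by rewrite -scalerAr -scalerDr -[_ + _]/(eval_at _ _) -slice_funE.
Qed.

Lemma stemZ k (F : cplx R -> cplx (DH R)) :
  stem D F -> stem D (fun z => k *: F z).
Proof.
by move=> sF z Dz; rewrite sF //; apply: cplxP; rewrite //= scalerN.
Qed.

Lemma stem_conj (F : cplx R -> cplx (DH R)) :
  stem D F -> stem D (@dhc_conj R \o F).
Proof. by move=> sF z Dz; rewrite /= sF // dhc_conj_bar. Qed.

Lemma star_algebra_S10 : star_algebra (S10 D) slice_mul slice_conj.
Proof.
split.
- exact: S10_0.
- exact: S10_add.
- by move=> k u Su; rewrite scale_fun_rscale; exact: S10_mulr.
- by move=> u v [[? ?] uG] [[? ?] vG]; eexists; exact: S10_dataM uG vG.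
- move=> _ _ _ /S10_stem[F sF ->] /S10_stem[F' sF' ->] /S10_stem[F'' sF'' ->].
  have sM1 := stemM sF sF'; have sM2 := stemM sF' sF''.
  rewrite !slice_mulE //; apply: eq_slice_fun => z _ /=; exact: mulrA.
- move=> _ _ _ /S10_stem[F sF ->] /S10_stem[F' sF' ->] /S10_stem[F'' sF'' ->].
  have sFF' := stemD sF sF'.
  rewrite slice_funD !slice_mulE // slice_funD.
  by apply: eq_slice_fun => z _ /=; exact: mulrDl.
- move=> _ _ _ /S10_stem[F sF ->] /S10_stem[F' sF' ->] /S10_stem[F'' sF'' ->].
  have sFF' := stemD sF' sF''.
  rewrite slice_funD !slice_mulE // slice_funD.
  by apply: eq_slice_fun => z _ /=; exact: mulrDr.
- move=> k _ _ /S10_stem[F sF ->] /S10_stem[F' sF' ->].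
  have skF := stemZ k sF; rewrite slice_funZ !slice_mulE // slice_funZ.
  by apply: eq_slice_fun => z _ /=; rewrite cplx_scaleAl.
- move=> k _ _ /S10_stem[F sF ->] /S10_stem[F' sF' ->].
  have skF' := stemZ k sF'; rewrite slice_funZ !slice_mulE // slice_funZ.
  by apply: eq_slice_fun => z _ /=; rewrite cplx_scaleAr.
- exists (slice_fun (fun=> mkcplx 1 0)); first exact: S10_cst.
  have s1 := @stem_cst R D _ (1 : DH R).
  move=> _ /S10_stem[F sF ->]; rewrite !slice_mulE //.
  split; apply: eq_slice_fun => z _; [exact: mul1r|exact: mulr1].
- by move=> u [[? ?] uG]; eexists; exact: S10_data_conj uG.
- move=> _ _ /S10_stem[F sF ->] /S10_stem[F' sF' ->].
  have sFF' := stemD sF sF'; rewrite slice_funD !slice_conjE // slice_funD.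
  by apply: eq_slice_fun => z _ /=; exact: dhc_conjD.
- move=> k _ /S10_stem[F sF ->].
  have skF := stemZ k sF; rewrite slice_funZ !slice_conjE // slice_funZ.
  by apply: eq_slice_fun => z _ /=; exact: dhc_conjZ.
- move=> _ _ /S10_stem[F sF ->] /S10_stem[F' sF' ->].
  have sM := stemM sF sF'; have scF := stem_conj sF; have scF' := stem_conj sF'.
  rewrite slice_mulE // !slice_conjE // slice_mulE //.
  by apply: eq_slice_fun => z _ /=; exact: dhc_conjM.
- move=> _ /S10_stem[F sF ->]; have scF := stem_conj sF.
  rewrite !slice_conjE //.
  by apply: eq_slice_fun => z _ /=; exact: dhc_conjK.
Qed.

End SliceAlgebra.

Theorem proposition6p1 (R : realType) (D : set (cplx R))
    (hD : open D) (hDbar : forall z, D z -> D (cplx_bar z)) :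
  [/\ right_module (@fun_rscale _ (DH R)) (DS D),
      right_module_iso (@fun_rscale _ (DH R)) (@fun_rscale _ (DH R))
        (S10 D) (DS D) natural_ext /\
      (forall f, S10 D f -> restr_Omega (natural_ext f) = f) /\
      (forall g, DS D g -> S10 D (restr_Omega g) /\
         natural_ext (restr_Omega g) = g),
      exists mul conj,
        star_algebra_iso (S10 D) slice_mul slice_conj
          (DS D) mul conj natural_ext /\
        (forall mul' conj',
          star_algebra_iso (S10 D) slice_mul slice_conj
            (DS D) mul' conj' natural_ext ->
          (forall g h, DS D g -> DS D h -> mul' g h = mul g h) /\
          (forall g, DS D g -> conj' g = conj g))
    & forall f, S10 D f ->
        [/\ S10 D (f \o conj_Omega),
            natural_ext (f \o conj_Omega) =
              natural_ext f \o conj_Omegacheck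
          & DS D (natural_ext f \o conj_Omegacheck)]].
Proof.
have extD := @natural_extD R D hD hDbar.
have exta := @natural_ext_mulr R D hD hDbar.
have extK := @natural_ext_restr R D hD hDbar.
have S10conj f : S10 D f -> S10 D (f \o conj_Omega).
  by move=> [[? ?] fG]; eexists; exact: (S10_data_conj_Omega hD fG).
have modDS : right_module (@fun_rscale _ (DH R)) (DS D).
  by apply: right_module_image (right_module_S10 hD) _ _ => // u a; exact: exta.
have extZ (k : R) u : S10 D u -> natural_ext (k *: u) = k *: natural_ext u.
  by move=> Su; rewrite !scale_fun_rscale exta.
have algI := star_algebra_transport (star_algebra_S10 hD) extD extZ extK.
split=> //.
- split; [split=> //|split=> //].
  + exact: right_module_S10.
  + by case: algI.
  + by move=> _ [f Sf <-]; rewrite extK.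
- eexists; eexists; split; first exact: algI.
  by move=> mul' conj'; exact: star_algebra_iso_unique.
- move=> f Sf; rewrite -(natural_ext_conj_Omega hD hDbar Sf); split=> //.
    exact: S10conj.
  by exists (f \o conj_Omega) => //; exact: S10conj.
Qed.
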